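(* Let $\psi\in\mathrm{Skew}$ with $c_{x_0x_1}(\psi)=0$. Then the following four conditions are equivalent: (i) $\psi\in\mathfrak{rc}_0$; (ii) $l^{y,x}_{\mathbf a,(b_1)}(\alpha(\psi))=0$ for all indices $\mathbf a$ and all $b_1\ge1$; (iii) $l^{x,y}_{\mathbf a,(b_1)}(\alpha(\psi))=0$ for all indices $\mathbf a$ and all $b_1\ge1$; (iv) $\mu(\eta)=d^R_1(\eta)(x_0+x_1,0)-d^R_1(\eta)-d^R_1(\eta)(x_1,0)$, where $\eta:=\psi(-x_0-x_1,x_1)$.
   Context: Let $k$ be a field of characteristic zero, $A=k\langle\langle x_0,x_1\rangle\rangle$ the algebra of noncommutative formal power series with counit $\varepsilon$ (constant term), $c_w(\varphi)$ the coefficient of the word $w$ in $\varphi\in A$, and $\mathfrak{fr}_k(x_0,x_1)\subset A$ the (completed) free Lie algebra of formal Lie series. $\mathfrak{fr}^{>1}_k(x_0,x_1)$ is the set of $\psi\in\mathfrak{fr}_k(x_0,x_1)$ with $\psi(x_0,0)=\psi(0,x_1)=0$, and $\mathrm{Skew}=\{\psi\in\mathfrak{fr}^{>1}_k(x_0,x_1)\mid\psi(x_0,x_1)=-\psi(x_1,x_0)\}$. Every $\varphi\in A$ is uniquely written $\varphi=\varepsilon(\varphi)+x_0d^R_0(\varphi)+x_1d^R_1(\varphi)=\varepsilon(\varphi)+d^L_0(\varphi)x_0+d^L_1(\varphi)x_1$. For a series $\theta\in A$, $\theta(u,v)$ denotes substitution $x_0\mapsto u,x_1\mapsto v$. The reduced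 coaction $\mu:A\to A$ is the (continuous) linear map with $\mu(x_0)=\mu(x_1)=0$ and $\mu(k_1\cdots k_n)=\sum_{i=1}^{n-1}k_1\cdots k_{i-1}(k_i\odot k_{i+1})k_{i+2}\cdots k_n$ for letters $k_j\in\{x_0,x_1\}$, where $x_i\odot x_j=\delta_{ij}x_i$. For a Lie series $\eta$ with $c_{x_0}(\eta)=c_{x_1}(\eta)=0$ let $r_\eta(x)=\sum_{l\ge0}c_{x_0^{l+1}x_1}(\eta)x^{l+1}$. The reduced coaction equation for $\eta$ is $\mu(\eta)=-r_\eta(x_1)+r_\eta(-x_0)-d^L_0(\eta)-d^R_1(\eta)$. $\mathfrak{rc}$ is the set of $\psi\in\mathrm{Skew}$ satisfying this equation, and $\mathfrak{rc}_0\subset\mathfrak{rc}$ is the subset of elements whose coefficient of the commutator $[x_0,x_1]$ is $0$. Pentagon defect. $\mathfrak p_5$ is the (degree-completed) Lie algebra over $k$ with generators $x_{ij}=x_{ji}$ ($1\le i,j\le5$) and relations $x_{ii}=0$, $\sum_{j=1}^5x_{ij}=0$ for all $i$, and $[x_{ij},x_{kl}]=0$ if $\{i,j\}\cap\{k,l\}=\emptyset$. Write $\psi_{ijk}:=\psi(x_{ij},x_{jk})\in\mathfrak p_5$. The defect is $\alpha(\psi):=\psi_{451}+\psi_{123}-\psi_{432}-\psi_{215}-\psi_{543}$. Polylogarithmic functionals. An index is a tuple $\mathbf a=(a_1,\dots,a_k)$, $k\ge1$, of positive integers; its depth is $k$. The degree-one part of $\mathfrak p_5$ has basis $x_{45},x_{34},x_{24},x_{12},x_{23}$;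 let $\omega_{45},\omega_{34},\omega_{24},\omega_{12},\omega_{23}$ be the dual basis (corresponding to $\frac{dy}{y},\frac{dy}{y-1},\frac{d(xy)}{xy-1},\frac{dx}{x},\frac{dx}{x-1}$). The word $[\omega_{i_m}|\cdots|\omega_{i_1}]$ (multilinear in its entries) is the functional extracting the coefficient of $x_{i_m}\cdots x_{i_1}$ from a noncommutative series in these five generators; combinations of words satisfying Chen's integrability condition descend to functionals on the completed $U\mathfrak p_5$. The following combinations are integrable. For $\mathbf a=(a_1,\dots,a_k)$ put $l^{y}_{\mathbf a}=(-1)^k[\omega_{45}^{a_k-1}|\omega_{34}|\cdots|\omega_{45}^{a_1-1}|\omega_{34}]$ and $l^{xy}_{\mathbf a}=(-1)^k[(\omega_{12}+\omega_{45})^{a_k-1}|\omega_{24}|\cdots|(\omega_{12}+\omega_{45})^{a_1-1}|\omega_{24}]$ (powers denote repeated tensor entries). With the conventions $l^{x,y}_{\emptyset,\mathbf b}:=l^y_{\mathbf b}$ and $l^{x,y}_{\mathbf a,\emptyset}:=l^{xy}_{\mathbf a}$, define recursively, for $\mathbf a=(a_1,\dots,a_k)$, $\mathbf b=(b_1,\dots,b_l)$, $k,l\ge1$: $l^{x,y}_{\mathbf a,\mathbf b}=X+Y$, where $X=[\omega_{12}|l^{x,y}_{(a_1,\dots,a_{k-1},a_k-1),\mathbf b}]$ if $a_k\ne1$, and $X=-[\omega_{23}|l^{x,y}_{(a_1,\dots,a_{k-1}),\mathbf b}]-[\omega_{12}-\omega_{23}|l^{x,y}_{(a_1,\dots,a_{k-1},b_1),(b_2,\dots,b_l)}]$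 if $a_k=1$; $Y=[\omega_{45}|l^{x,y}_{\mathbf a,(b_1,\dots,b_{l-1},b_l-1)}]$ if $b_l\ne1$, and $Y=-[\omega_{34}|l^{x,y}_{\mathbf a,(b_1,\dots,b_{l-1})}]$ if $b_l=1$. (This is the bar-construction element of the iterated integral $\mathrm{Li}_{\mathbf a,\mathbf b}(x,y)=\sum_{0<m_1<\dots<m_k<n_1<\dots<n_l}\frac{x^{m_k}y^{n_l}}{m_1^{a_1}\cdots m_k^{a_k}n_1^{b_1}\cdots n_l^{b_l}}$.) Finally $l^{y,x}_{\mathbf a,\mathbf b}$ (corresponding to $\mathrm{Li}_{\mathbf a,\mathbf b}(y,x)$) is obtained from $l^{x,y}_{\mathbf a,\mathbf b}$ by exchanging $\omega_{12}\leftrightarrow\omega_{45}$ and $\omega_{23}\leftrightarrow\omega_{34}$ and fixing $\omega_{24}$. *)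

(* Defs.v *)
From HB Require Import structures.
From mathcomp Require Import all_boot all_order all_algebra.
From mathcomp Require Import generic_quotient ring_quotient.
From mathcomp Require Import boolp classical_sets.

Set Implicit Arguments.
Unset Strict Implicit.
Unset Printing Implicit Defensive.

Import GRing.Theory.
Local Open Scope ring_scope.
Local Open Scope quotient_scope.

(* k<<X>>: a series is the family of its coefficients, [f w] being the
   coefficient of the word [w].  The ring structure is concatenation product
   (not the pointwise product of functions). *)
Definition series (k : Type) (X : Type) : Type := seq X -> k.

Section SeriesRing.
Variables (k : comNzRingType) (X : choiceType).
Implicit Types f g h : series k X.

HB.instance Definition _ := gen_eqMixin (series k X).
HB.instance Definition _ := gen_choiceMixin (series k X).

Definition szero : series k X := fun=> 0.
Definition sopp f : series k X := fun w => - f w.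
Definition sadd f g : series k X := fun w => f w + g w.

Fact saddA : associative sadd.
Proof. by move=> f g h; apply: funext => w; rewrite /sadd addrA. Qed.
Fact saddC : commutative sadd.
Proof. by move=> f g; apply: funext => w; rewrite /sadd addrC. Qed.
Fact sadd0 : left_id szero sadd.
Proof. by move=> f; apply: funext => w; rewrite /sadd add0r. Qed.
Fact saddN : left_inverse szero sopp sadd.
Proof. by move=> f; apply: funext => w; rewrite /sadd addNr. Qed.

HB.instance Definition _ :=
  GRing.isZmodule.Build (series k X) saddA saddC sadd0 saddN.

Definition sone : series k X := fun w => (w == [::])%:R.
Definition smul f g : series k X :=
  fun w => \sum_(i < (size w).+1) f (take i w) * g (drop i w).

(* For a letter x, dR x and dL x are characterised by
   f = f [::] + \sum_x x * dR x f = f [::] + \sum_x dL x f * x. *)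
Definition dR (x : X) f : series k X := fun w => f (x :: w).
Definition dL (x : X) f : series k X := fun w => f (rcons w x).

Lemma saddE f g w : (f + g) w = f w + g w. Proof. by []. Qed.
Lemma soppE f w : (- f) w = - f w. Proof. by []. Qed.
Lemma szeroE w : (0 : series k X) w = 0. Proof. by []. Qed.
Lemma ssumE I (r : seq I) (P : pred I) (F : I -> series k X) w :
  (\sum_(i <- r | P i) F i) w = \sum_(i <- r | P i) F i w.
Proof. by apply: (big_morph (fun f : series k X => f w)). Qed.

Fact smul_nil f g : smul f g [::] = f [::] * g [::].
Proof. by rewrite /smul big_ord1. Qed.
Fact smul_cons f g x w :
  smul f g (x :: w) = f [::] * g (x :: w) + smul (dR x f) g w.
Proof. by rewrite /smul big_ord_recl. Qed.

Fact smulDl : left_distributive smul +%R.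
Proof.
move=> f g h; apply: funext => w; rewrite saddE /smul -big_split.
by apply: eq_bigr => i _; rewrite saddE mulrDl.
Qed.
Fact smulDr : right_distributive smul +%R.
Proof.
move=> f g h; apply: funext => w; rewrite saddE /smul -big_split.
by apply: eq_bigr => i _; rewrite saddE mulrDr.
Qed.

Definition sscale (a : k) f : series k X := fun w => a * f w.

Fact sscaleAl a f g : sscale a (smul f g) = smul (sscale a f) g.
Proof.
apply: funext => w; rewrite /sscale /smul mulr_sumr.
by apply: eq_bigr => i _; rewrite mulrA.
Qed.
Fact sscaleAr a f g : sscale a (smul f g) = smul f (sscale a g).
Proof.
apply: funext => w; rewrite /sscale /smul mulr_sumr.
by apply: eq_bigr => i _; rewrite mulrCA.
Qed.

Fact dR_smul x f g :
  dR x (smul f g) = sscale (f [::]) (dR x g) + smul (dR x f) g.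
Proof. by apply: funext => w; rewrite /dR smul_cons. Qed.

Fact smulA : associative smul.
Proof.
move=> f g h; apply: funext => w; elim: w f g => [|x w IH] f g.
  by rewrite !smul_nil mulrA.
rewrite !smul_cons dR_smul smulDl saddE -sscaleAl -IH smul_nil mulrDr.
by rewrite -!addrA -mulrA.
Qed.
Fact smul1l : left_id sone smul.
Proof.
move=> f; apply: funext => -[|x w]; first by rewrite smul_nil mul1r.
rewrite smul_cons mul1r /smul big1 ?addr0 // => i _.
by rewrite /dR /sone mul0r.
Qed.
Fact smul1r : right_id sone smul.
Proof.
move=> f; apply: funext => w; elim: w f => [|x w IH] f.
  by rewrite smul_nil mulr1.
by rewrite smul_cons IH mulr0 add0r.
Qed.
Fact sone_neq0 : sone != 0.
Proof.
apply/negP => /eqP/(congr1 (fun f : series k X => f [::])).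
by move/eqP; rewrite oner_eq0.
Qed.

HB.instance Definition _ := GRing.Zmodule_isNzRing.Build (series k X)
  smulA smul1l smul1r smulDl smulDr sone_neq0.

Fact sscaleA a b f : sscale a (sscale b f) = sscale (a * b) f.
Proof. by apply: funext => w; rewrite /sscale mulrA. Qed.
Fact sscale1 : left_id 1 sscale.
Proof. by move=> f; apply: funext => w; rewrite /sscale mul1r. Qed.
Fact sscaleDr : right_distributive sscale +%R.
Proof. by move=> a f g; apply: funext => w; rewrite /sscale mulrDr. Qed.
Fact sscaleDl f : {morph sscale^~ f : a b / a + b}.
Proof. by move=> a b; apply: funext => w; rewrite /sscale mulrDl. Qed.

HB.instance Definition _ := GRing.Zmodule_isLmodule.Build k (series k X)
  sscaleA sscale1 sscaleDr sscaleDl.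
HB.instance Definition _ :=
  GRing.Lmodule_isLalgebra.Build k (series k X) sscaleAl.
HB.instance Definition _ :=
  GRing.Lalgebra_isAlgebra.Build k (series k X) sscaleAr.

Lemma soneE w : (1 : series k X) w = (w == [::])%:R. Proof. by []. Qed.
Lemma smulE f g w :
  (f * g) w = \sum_(i < (size w).+1) f (take i w) * g (drop i w).
Proof. by []. Qed.
Lemma smul_nilE f g : (f * g) [::] = f [::] * g [::].
Proof. exact: smul_nil. Qed.
Lemma smul_consE f g x w :
  (f * g) (x :: w) = f [::] * g (x :: w) + (dR x f * g) w.
Proof. exact: smul_cons. Qed.
Lemma sscaleE a f w : (a *: f) w = a * f w. Proof. by []. Qed.

Definition coef (w : seq X) f : k := f w.

Definition letter (x : X) : series k X := fun w => (w == [:: x])%:R.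
Definition bracket f g : series k X := f * g - g * f.

Definition hcomp (n : nat) f : series k X :=
  fun w => if size w == n then f w else 0.

(* The (uncompleted) free Lie algebra on X, inside k<<X>>. *)
Inductive lie_poly : series k X -> Prop :=
  | lie_poly0 : lie_poly 0
  | lie_poly_letter x : lie_poly (letter x)
  | lie_polyD f g : lie_poly f -> lie_poly g -> lie_poly (f + g)
  | lie_polyZ a f : lie_poly f -> lie_poly (a *: f)
  | lie_poly_bracket f g :
      lie_poly f -> lie_poly g -> lie_poly (bracket f g).

Definition lie_series f : Prop := forall n, lie_poly (hcomp n f).

End SeriesRing.

Arguments letter {k X} x.
Arguments coef {k X} w f.

(* [subst s f] is f with s x substituted for each letter x; it is used only
   when all s x have zero constant term, so that words t longer than w do not
   contribute to the coefficient of w. *)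
Definition subst (k : comNzRingType) (X : finType) (Y : choiceType)
    (s : X -> series k Y) (f : series k X) : series k Y :=
  fun w => \sum_(n < (size w).+1) \sum_(t : n.-tuple X)
             f t * (\prod_(x <- t) s x) w.

Section LieClosure.
Variables (k : comNzRingType) (X : choiceType).
Implicit Types f g : series k X.

Lemma hcomp0 n : hcomp n (0 : series k X) = 0.
Proof. by apply: funext => w; rewrite /hcomp; case: ifP. Qed.
Lemma hcompD n f g : hcomp n (f + g) = hcomp n f + hcomp n g.
Proof.
by apply: funext => w; rewrite saddE /hcomp; case: ifP => // _; rewrite addr0.
Qed.
Lemma hcompN n f : hcomp n (- f) = - hcomp n f.
Proof.
by apply: funext => w; rewrite soppE /hcomp; case: ifP => // _; rewrite oppr0.
Qed.
Lemma hcompB n f g : hcomp n (f - g) = hcomp n f - hcomp n g.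
Proof. by rewrite hcompD hcompN. Qed.
Lemma hcompZ n a f : hcomp n (a *: f) = a *: hcomp n f.
Proof.
by apply: funext => w; rewrite sscaleE /hcomp; case: ifP => // _; rewrite mulr0.
Qed.
Lemma hcomp_sum n I (r : seq I) (P : pred I) (F : I -> series k X) :
  hcomp n (\sum_(i <- r | P i) F i) = \sum_(i <- r | P i) hcomp n (F i).
Proof. by apply: (big_morph (hcomp n) (hcompD n) (hcomp0 n)). Qed.

Lemma hcompM n f g :
  hcomp n (f * g) = \sum_(i < n.+1) hcomp i f * hcomp (n - i) g.
Proof.
apply: funext => w; rewrite ssumE /hcomp.
case: eqP => [wn|/eqP wn].
  rewrite smulE wn; apply: eq_bigr => i _; rewrite smulE wn.
  have in_ : (i <= n)%N by rewrite -ltnS.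
  rewrite (bigD1 i) //= big1 ?addr0 => [|j ji].
    by rewrite size_takel ?wn // eqxx size_drop wn eqxx.
  by rewrite size_takel ?wn -1?ltnS // ifN ?mul0r.
rewrite big1 // => i _; rewrite smulE big1 // => j _.
case: ifP => [/eqP ji|]; last by rewrite mul0r.
rewrite ifN ?mulr0 //; apply: contraNneq wn => jd.
by rewrite -(cat_take_drop j w) size_cat ji jd subnKC // -ltnS.
Qed.

Lemma lie_polyN f : lie_poly f -> lie_poly (- f).
Proof. by move=> hf; rewrite -scaleN1r; apply: lie_polyZ. Qed.
Lemma lie_poly_sum I (r : seq I) (P : pred I) (F : I -> series k X) :
  (forall i, P i -> lie_poly (F i)) -> lie_poly (\sum_(i <- r | P i) F i).
Proof.
by move=> h; apply: (big_ind (@lie_poly k X)) => //;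
  [exact: lie_poly0 | exact: lie_polyD].
Qed.

Lemma lie_series0 : lie_series (0 : series k X).
Proof. by move=> n; rewrite hcomp0; exact: lie_poly0. Qed.
Lemma lie_seriesB f g : lie_series f -> lie_series g -> lie_series (f - g).
Proof.
by move=> hf hg n; rewrite hcompB; apply: lie_polyD => //; apply: lie_polyN.
Qed.
Lemma lie_seriesD f g : lie_series f -> lie_series g -> lie_series (f + g).
Proof. by move=> hf hg n; rewrite hcompD; apply: lie_polyD. Qed.
Lemma lie_seriesZ a f : lie_series f -> lie_series (a *: f).
Proof. by move=> hf n; rewrite hcompZ; apply: lie_polyZ. Qed.
Lemma lie_series_letter x : lie_series (letter x : series k X).
Proof.
move=> n; have [->|n1] := eqVneq n 1%N.
  suff -> : hcomp 1 (letter x : series k X) = letter x by exact: lie_poly_letter.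
  apply: funext => w; rewrite /hcomp /letter; case: eqP => // w1.
  by case: eqP w1 => // w1 []; rewrite w1.
suff -> : hcomp n (letter x : series k X) = 0 by exact: lie_poly0.
apply: funext => w; rewrite /hcomp /letter; case: eqP => // wn.
by case: eqP => // wx; move: n1; rewrite -wn wx.
Qed.
Lemma lie_series_bracket f g :
  lie_series f -> lie_series g -> lie_series (bracket f g).
Proof.
move=> hf hg n; rewrite /bracket hcompB !hcompM.
rewrite [X in _ - X](reindex_inj rev_ord_inj) /= -sumrB.
apply: lie_poly_sum => i _.
by rewrite subSS subKn -1?ltnS //; apply: lie_poly_bracket.
Qed.
Lemma lie_series_poly f : lie_poly f -> lie_series f.
Proof.
elim=> [|x|{}f g _ hf _ hg|a {}f _ hf|{}f g _ hf _ hg].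
- exact: lie_series0.
- exact: lie_series_letter.
- exact: lie_seriesD.
- exact: lie_seriesZ.
- exact: lie_series_bracket.
Qed.
Lemma lie_series_const f : lie_series f -> f [::] = 0.
Proof.
move=> /(_ 0%N) h; suff : (hcomp 0 f) [::] = 0 by [].
elim: h => [|x|{}f g _ hf _ hg|a {}f _ hf|{}f g _ hf _ hg] //.
- by rewrite saddE hf hg addr0.
- by rewrite sscaleE hf mulr0.
- by rewrite /bracket saddE soppE !smul_nilE hf hg mulr0 subr0.
Qed.

End LieClosure.

Section SubstLie.
Variables (k : comNzRingType) (X : finType) (Y : choiceType).
Variable s : X -> series k Y.
Hypothesis s0 : forall x, s x [::] = 0.
Implicit Types f g : series k X.

Lemma substE_ge f w N : (size w < N)%N -> subst s f w =
  \sum_(n < N) \sum_(t : n.-tuple X) f t * (\prod_(x <- t) s x) w.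
Proof.
have prod0 (t : seq X) v : (size v < size t)%N -> (\prod_(x <- t) s x) v = 0.
  elim: t v => // x t IH v vt; rewrite big_cons smulE big1 // => -[[|i] ilt] _.
    by rewrite take0 s0 mul0r.
  rewrite [X in _ * X]IH ?mulr0 //=; move: vt; rewrite /= size_drop.
  case: v ilt => [|y v] //= _; rewrite subSS ltnS => vt.
  exact: leq_ltn_trans (leq_subr _ _) vt.
move=> wN; rewrite /subst (big_ord_widen N (fun n => \sum_(t : n.-tuple X)
  f t * (\prod_(x <- t) s x) w)) // [RHS](bigID (fun n : 'I_N => n < (size w).+1)%N).
rewrite /= [X in _ + X]big1 ?addr0 // => n; rewrite -leqNgt => wn.
by rewrite big1 // => t _; rewrite prod0 ?mulr0 // size_tuple.
Qed.

Lemma substD f g : subst s (f + g) = subst s f + subst s g.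
Proof.
apply: funext => w; rewrite saddE /subst -big_split; apply: eq_bigr => n _.
by rewrite -big_split; apply: eq_bigr => t _; rewrite saddE mulrDl.
Qed.
Lemma substZ a f : subst s (a *: f) = a *: subst s f.
Proof.
apply: funext => w; rewrite sscaleE /subst mulr_sumr; apply: eq_bigr => n _.
by rewrite mulr_sumr; apply: eq_bigr => t _; rewrite sscaleE mulrA.
Qed.
Lemma subst0 : subst s 0 = 0.
Proof. by rewrite -(scale0r 0) substZ !scale0r. Qed.
Lemma substN f : subst s (- f) = - subst s f.
Proof. by rewrite -scaleN1r substZ scaleN1r. Qed.
Lemma substB f g : subst s (f - g) = subst s f - subst s g.
Proof. by rewrite substD substN. Qed.

Lemma subst_rec f : subst s f = (f [::])%:A + \sum_x s x * subst s (dR x f).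
Proof.
apply: funext => w; rewrite (@substE_ge _ _ (size w).+2) // big_ord_recl.
rewrite saddE; congr (_ + _).
  rewrite (big_pred1 [tuple]) => [|t]; last by apply/esym/eqP; rewrite tuple0.
  by rewrite big_nil.
transitivity (\sum_(n < (size w).+1) \sum_(x : X) \sum_(t : n.-tuple X)
    f (x :: t) * (s x * \prod_(y <- t) s y) w).
  apply: eq_bigr => n _.
  rewrite pair_bigA /= (reindex (fun p : X * n.-tuple X => [tuple of p.1 :: p.2])).
    by apply: eq_bigr => p _; rewrite /= big_cons.
  exists (fun t : n.+1.-tuple X => (thead t, [tuple of behead t])).
    by move=> [x t] _ /=; congr pair; apply: val_inj.
  by move=> t _; rewrite [RHS]tuple_eta; apply: val_inj.
rewrite exchange_big ssumE /=; apply: eq_bigr => x _.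
rewrite smulE; under eq_bigr do under eq_bigr do rewrite smulE mulr_sumr.
rewrite (eq_bigr (fun n : 'I_(size w).+1 => \sum_(i < (size w).+1)
  \sum_(t : n.-tuple X) f (x :: t) *
    (s x (take i w) * (\prod_(y <- t) s y) (drop i w)))); last first.
  by move=> n _; rewrite exchange_big.
rewrite exchange_big; apply: eq_bigr => i _ /=.
rewrite (@substE_ge _ _ (size w).+1) ?ltnS ?size_drop ?leq_subr //.
rewrite mulr_sumr; apply: eq_bigr => n _; rewrite mulr_sumr.
by apply: eq_bigr => t _; rewrite /dR mulrCA.
Qed.

Lemma subst_letter x : subst s (letter x) = s x.
Proof.
rewrite subst_rec /letter /= scale0r add0r (bigD1 x) //= big1 ?addr0 => [|y yx].
  rewrite (_ : dR x _ = 1); last first.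
    by apply: funext => -[|z w]; rewrite /dR soneE eqseq_cons eqxx.
  rewrite [subst _ _]subst_rec soneE eqxx scale1r big1 ?addr0 ?mulr1 // => y _.
  by rewrite (_ : dR y 1 = 0) ?subst0 ?mulr0.
rewrite (_ : dR y _ = 0) ?subst0 ?mulr0 //; apply: funext => w.
by rewrite /dR eqseq_cons (negPf yx).
Qed.

Lemma substM f g : subst s (f * g) = subst s f * subst s g.
Proof.
suff H n : forall f g w, (size w < n)%N ->
    subst s (f * g) w = (subst s f * subst s g) w.
  by apply: funext => w; apply: (H (size w).+1).
elim: n => // n IH {}f {}g w wn.
rewrite [subst s (f * g)]subst_rec [subst s f]subst_rec mulrDl -scalerAl mul1r.
rewrite {1}(subst_rec g) smul_nilE -scalerA scalerDr.
rewrite -addrA !saddE; congr (_ + _).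
rewrite scaler_sumr mulr_suml -saddE -big_split /= !ssumE.
apply: eq_bigr => x _.
rewrite (_ : dR x (f * g) = f [::] *: dR x g + dR x f * g); last exact: dR_smul.
rewrite substD substZ mulrDr scalerAr !saddE; congr (_ + _).
rewrite -mulrA !smulE; apply: eq_bigr => -[[|i] ilt] _ /=.
  by rewrite take0 s0 !mul0r.
case: w wn ilt => [|y w] // wn ilt; congr (_ * _).
by rewrite IH //= size_drop (leq_ltn_trans (leq_subr _ _)).
Qed.

Lemma hcomp_subst_lt f n m : (n < m)%N -> (forall t, (size t < m)%N -> f t = 0) ->
  hcomp n (subst s f) = 0.
Proof.
move=> nm hf; apply: funext => w; rewrite /hcomp; case: eqP => // wn.
rewrite /subst big1 // => j _; rewrite big1 // => t _.
by rewrite hf ?mul0r // size_tuple (leq_trans (ltn_ord j)) // wn.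
Qed.

Lemma lie_series_subst f :
  (forall x, lie_series (s x)) -> lie_series f -> lie_series (subst s f).
Proof.
move=> hs hf n.
have hp p : lie_poly p -> lie_series (subst s p).
  elim=> [|x|{}p q _ hp _ hq|a {}p _ hp|{}p q _ hp _ hq].
  - by rewrite subst0; apply: lie_series0.
  - by rewrite subst_letter.
  - by rewrite substD; apply: lie_seriesD.
  - by rewrite substZ; apply: lie_seriesZ.
  - by rewrite /bracket substB !substM; apply: lie_series_bracket.
suff -> : hcomp n (subst s f) =
    \sum_(m < n.+1) hcomp n (subst s (hcomp m f)).
  by apply: lie_poly_sum => m _; apply: hp; apply: hf.
pose g := f - \sum_(m < n.+1) hcomp m f.
have fE : f = g + \sum_(m < n.+1) hcomp m f by rewrite subrK.
rewrite {1}fE substD hcompD (@hcomp_subst_lt g n n.+1) // ?add0r.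
  by rewrite -hcomp_sum; congr hcomp; apply: (big_morph (subst s) substD subst0).
move=> t tn; rewrite /g saddE soppE ssumE (bigD1 (Ordinal tn)) //=.
rewrite /hcomp eqxx big1 ?addr0 ?subrr // => m; rewrite -val_eqE /= eq_sym.
by move/negPf => ->.
Qed.

End SubstLie.

Section FreeLie.
Variables (k : comNzRingType) (X : choiceType).

Definition lie_pred : {pred series k X} := fun f => `[< lie_series f >].

Fact lie_pred_zmod : zmod_closed lie_pred.
Proof.
split=> [|f g /asboolP hf /asboolP hg]; apply/asboolP.
  exact: lie_series0.
exact: lie_seriesB.
Qed.
HB.instance Definition _ :=
  GRing.isZmodClosed.Build (series k X) lie_pred lie_pred_zmod.

Record fr := Fr { fr_val :> series k X; fr_valP : fr_val \in lie_pred }.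
HB.instance Definition _ := [isSub for fr_val].
HB.instance Definition _ := [Choice of fr by <:].
HB.instance Definition _ := [SubChoice_isSubZmodule of fr by <:].

Definition fr_letter (x : X) : fr := Fr (asboolT (lie_series_letter k x)).

Section Presentation.
(* Used for sets rel of homogeneous Lie polynomials of positive degree; the
   closed ideals below are then the degreewise completions of the ideals. *)
Variable rel : series k X -> Prop.

Inductive lie_ideal : series k X -> Prop :=
  | lie_ideal_rel r : rel r -> lie_ideal r
  | lie_ideal0 : lie_ideal 0
  | lie_idealD f g : lie_ideal f -> lie_ideal g -> lie_ideal (f + g)
  | lie_idealZ a f : lie_ideal f -> lie_ideal (a *: f)
  | lie_ideal_bracket f g :
      lie_poly f -> lie_ideal g -> lie_ideal (bracket f g).

Inductive env_ideal : series k X -> Prop :=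
  | env_ideal_rel r : rel r -> env_ideal r
  | env_ideal0 : env_ideal 0
  | env_idealD f g : env_ideal f -> env_ideal g -> env_ideal (f + g)
  | env_idealMl f g : env_ideal g -> env_ideal (f * g)
  | env_idealMr f g : env_ideal f -> env_ideal (f * g).

Definition lie_cideal : {pred fr} :=
  fun f => `[< forall n, lie_ideal (hcomp n f) >].
Definition env_cideal : {pred series k X} :=
  fun f => `[< forall n, env_ideal (hcomp n f) >].

Lemma env_idealZ a f : env_ideal f -> env_ideal (a *: f).
Proof. by move=> h; rewrite -mulr_algl; apply: env_idealMl. Qed.

Fact lie_cideal_zmod : zmod_closed lie_cideal.
Proof.
split=> [|f g /asboolP hf /asboolP hg]; apply/asboolP => n /=.
  by rewrite hcomp0; apply: lie_ideal0.
rewrite hcompB; apply: lie_idealD => //.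
by rewrite -scaleN1r; apply: lie_idealZ.
Qed.
HB.instance Definition _ := GRing.isZmodClosed.Build fr lie_cideal lie_cideal_zmod.

Fact env_cideal_zmod : zmod_closed env_cideal.
Proof.
split=> [|f g /asboolP hf /asboolP hg]; apply/asboolP => n.
  by rewrite hcomp0; apply: env_ideal0.
rewrite hcompB; apply: env_idealD => //.
by rewrite -scaleN1r; apply: env_idealZ.
Qed.
HB.instance Definition _ :=
  GRing.isZmodClosed.Build (series k X) env_cideal env_cideal_zmod.

(* The degree-completed Lie algebra with generators X and relations rel, as
   the quotient of the completed free Lie algebra by the closed Lie ideal. *)
Definition pres_lie := {ideal_quot lie_cideal}.
HB.instance Definition _ := GRing.Zmodule.on pres_lie.

(* Its completed universal enveloping algebra (only its additive structure is
   recorded): the associative algebra with the same generators and relations. *)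
Definition pres_env := {ideal_quot env_cideal}.
HB.instance Definition _ := GRing.Zmodule.on pres_env.

Definition pi_lie (f : fr) : pres_lie := \pi_({ideal_quot lie_cideal}) f.
Definition pi_env (f : series k X) : pres_env := \pi_({ideal_quot env_cideal}) f.

Definition to_env (z : pres_lie) : pres_env :=
  pi_env (fr_val (repr (z : {ideal_quot lie_cideal}))).

Lemma pi_lie_eq f g : (pi_lie f = pi_lie g) <-> f - g \in lie_cideal.
Proof. by rewrite Quotient.idealrBE; split=> [/eqP|/eqP]. Qed.
Lemma pi_env_eq f g : (pi_env f = pi_env g) <-> f - g \in env_cideal.
Proof. by rewrite Quotient.idealrBE; split=> [/eqP|/eqP]. Qed.

Lemma env_ideal_lie f : lie_ideal f -> env_ideal f.
Proof.
elim=> [r|||a|{}f g _ _ hg]; [exact: env_ideal_rel|exact: env_ideal0| | |].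
- by move=> *; apply: env_idealD.
- by move=> *; apply: env_idealZ.
- apply: env_idealD; first exact: env_idealMl.
  by rewrite -scaleN1r; apply/env_idealZ/env_idealMr.
Qed.

Lemma to_envE f : to_env (pi_lie f) = pi_env (fr_val f).
Proof.
apply/pi_env_eq/asboolP => n; apply: env_ideal_lie.
have /pi_lie_eq/asboolP/(_ n) // : pi_lie (repr (pi_lie f)) = pi_lie f.
by rewrite /pi_lie reprK.
Qed.

End Presentation.
End FreeLie.

Arguments fr_letter {k X} x.

Definition fr_subst (k : comNzRingType) (X : finType) (Y : choiceType)
    (s : X -> fr k Y) (f : fr k X) : fr k Y :=
  Fr (asboolT (lie_series_subst
    (fun x => lie_series_const (asboolW (fr_valP (s x))))
    (fun x => asboolW (fr_valP (s x))) (asboolW (fr_valP f)))).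

(* The letters x0 and x1 are the booleans false and true. *)
Section TwoLetters.
Variable k : comNzRingType.
Local Notation A := (series k bool).

Definition x0 : A := letter false.
Definition x1 : A := letter true.

Definition subst2 (Y : choiceType) (u v : series k Y) (f : A) : series k Y :=
  subst (fun b : bool => if b then v else u) f.

Definition odot (i j : bool) : A := if i == j then letter i else 0.

Definition word_series (w : seq bool) : A := \prod_(x <- w) letter x.

Definition mu_word (w : seq bool) : A :=
  \sum_(i < (size w).-1)
    word_series (take i w) * odot (nth false w i) (nth false w i.+1)
      * word_series (drop i.+2 w).

(* The continuous linear extension of mu_word, which lowers degrees by one. *)
Definition mu (f : A) : A :=
  fun w => \sum_(v : (size w).+1.-tuple bool) f v * mu_word v w.

(* r_eta(u), for u without constant term. *)
Definition r_ (eta : A) (u : A) : A :=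
  fun w => \sum_(l < size w)
    coef (rcons (nseq l.+1 false) true) eta * coef w (u ^+ l.+1).

Definition reduced_coaction_eq (eta : A) : Prop :=
  mu eta = - r_ eta x1 + r_ eta (- x0) - dL false eta - dR true eta.

Definition fr_gt1 (psi : fr k bool) : Prop :=
  subst2 x0 0 psi = 0 /\ subst2 0 x1 psi = 0.

Definition Skew (psi : fr k bool) : Prop :=
  fr_gt1 psi /\ (psi : A) = - subst2 x1 x0 psi.

Definition rc (psi : fr k bool) : Prop := Skew psi /\ reduced_coaction_eq psi.

(* The degree two part of a Lie series is c [x0, x1], with c the coefficient
   of the word x0 x1. *)
Definition rc0 (psi : fr k bool) : Prop :=
  rc psi /\ coef [:: false; true] psi = 0.

End TwoLetters.

Arguments x0 {k}.
Arguments x1 {k}.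

Section Pentagon.
Variable k : comNzRingType.

(* x_ij is the letter (i, j); the five labels are taken modulo 5, so that the
   label 5 is the ordinal 0. *)
Definition p5_gens := ('I_5 * 'I_5)%type.

Definition p5_label (n : nat) : 'I_5 := inZp n.

Inductive p5_rel : series k p5_gens -> Prop :=
  | p5_sym i j : p5_rel (letter (i, j) - letter (j, i))
  | p5_diag i : p5_rel (letter (i, i))
  | p5_sum i : p5_rel (\sum_(j < 5) letter (i, j))
  | p5_comm i j l m : i \notin [:: l; m] -> j \notin [:: l; m] ->
      p5_rel (bracket (letter (i, j)) (letter (l, m))).

Definition p5 := pres_lie p5_rel.
HB.instance Definition _ := GRing.Zmodule.on p5.
Definition Up5 := pres_env p5_rel.
HB.instance Definition _ := GRing.Zmodule.on Up5.

Definition xf (i j : nat) : fr k p5_gens := fr_letter (p5_label i, p5_label j).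

Definition psi3 (psi : fr k bool) (i j l : nat) : p5 :=
  pi_lie p5_rel (fr_subst (fun b : bool => if b then xf j l else xf i j) psi).

Definition alpha (psi : fr k bool) : p5 :=
  psi3 psi 4 5 1 + psi3 psi 1 2 3
    - psi3 psi 4 3 2 - psi3 psi 2 1 5 - psi3 psi 5 4 3.

End Pentagon.

Inductive gen5 : Set := g45 | g34 | g24 | g12 | g23.

Definition gen5_code (e : gen5) : 'I_5 :=
  match e with
  | g45 => inZp 0 | g34 => inZp 1 | g24 => inZp 2 | g12 => inZp 3 | g23 => inZp 4
  end.
Definition gen5_decode (i : 'I_5) : gen5 :=
  nth g45 [:: g45; g34; g24; g12; g23] i.
Fact gen5_codeK : cancel gen5_code gen5_decode. Proof. by case. Qed.
HB.instance Definition _ := Finite.copy gen5 (can_type gen5_codeK).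

Definition gen5_p5 (e : gen5) : p5_gens :=
  let x i j := (p5_label i, p5_label j) in
  match e with
  | g45 => x 4%N 5%N | g34 => x 3%N 4%N | g24 => x 2%N 4%N
  | g12 => x 1%N 2%N | g23 => x 2%N 3%N
  end.

Section Bar.
Variable k : comNzRingType.

(* Linear forms on the degree one part of p5, in the basis dual to gen5. *)
Definition form := {ffun gen5 -> k}.
Definition omega (e : gen5) : form := [ffun e' => (e' == e)%:R].

(* Combinations of words in the forms, as functionals on series in the five
   generators: [bar_nil] is the empty word, and [bar_cons om l] is [om|l], the
   leftmost entry being paired with the leftmost letter. *)
Definition barfun := series k gen5 -> k.
Definition bar_nil : barfun := coef [::].
Definition bar_cons (om : form) (l : barfun) : barfun :=
  fun th => \sum_(e : gen5) om e * l (dR e th).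
Definition bar_word (s : seq form) : barfun := foldr bar_cons bar_nil s.

(* The words with entries u^{a_k-1}, v, ..., u^{a_1-1}, v. *)
Definition polylog_word (u v : form) (a : seq nat) : seq form :=
  flatten [seq rcons (nseq ai.-1 u) v | ai <- rev a].

Section Polylog.
(* [om e] is the form that plays the role of omega_e. *)
Variable om : gen5 -> form.

Definition l_y (b : seq nat) : barfun :=
  fun th => (-1) ^+ size b * bar_word (polylog_word (om g45) (om g34) b) th.
Definition l_xy (a : seq nat) : barfun :=
  fun th => (-1) ^+ size a *
    bar_word (polylog_word (om g12 + om g45) (om g24) a) th.

(* The recursion lowers the weight, the sum of all entries, by one; [n] bounds
   the weight, so that the last branch is not reached for positive entries. *)
Fixpoint l_rec (n : nat) (a b : seq nat) : barfun :=
  match a, b, n with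
  | [::], _, _ => l_y b
  | _, [::], _ => l_xy a
  | a1 :: a', b1 :: b', n'.+1 =>
      let ahd := belast a1 a' in let alast := last a1 a' in
      let bhd := belast b1 b' in let blast := last b1 b' in
      fun th =>
        (if alast != 1%N
         then bar_cons (om g12) (l_rec n' (rcons ahd alast.-1) b) th
         else - bar_cons (om g23) (l_rec n' ahd b) th
              - bar_cons (om g12 - om g23) (l_rec n' (rcons ahd b1) b') th)
        +
        (if blast != 1%N
         then bar_cons (om g45) (l_rec n' a (rcons bhd blast.-1)) th
         else - bar_cons (om g34) (l_rec n' a bhd) th)
  | _, _, 0%N => fun=> 0
  end.

Definition l_gen (a b : seq nat) : barfun := l_rec (sumn a + sumn b) a b.

Lemma l_gen_nill b : l_gen [::] b = l_y b.
Proof. by rewrite /l_gen; case: (_ + _)%N. Qed.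
Lemma l_gen_nilr a : a != [::] -> l_gen a [::] = l_xy a.
Proof. by rewrite /l_gen; case: a => // ? ?; case: (_ + _)%N. Qed.

(* The defining recursion, for positive last entries p.+1 and q.+1. *)
Lemma l_genE ahd p bhd q b1 b' : rcons bhd q.+1 = b1 :: b' ->
  l_gen (rcons ahd p.+1) (b1 :: b') = fun th =>
    (if p != 0%N then bar_cons (om g12) (l_gen (rcons ahd p) (b1 :: b')) th
     else - bar_cons (om g23) (l_gen ahd (b1 :: b')) th
          - bar_cons (om g12 - om g23) (l_gen (rcons ahd b1) b') th)
    + (if q != 0%N
       then bar_cons (om g45) (l_gen (rcons ahd p.+1) (rcons bhd q)) th
       else - bar_cons (om g34) (l_gen (rcons ahd p.+1) bhd) th).
Proof.
move=> bE; have sb : (sumn bhd + q.+1 = b1 + sumn b')%N.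
  by rewrite -sumn_rcons bE.
have [a1 [a' aE]] : exists a1 a', rcons ahd p.+1 = a1 :: a'.
  by case: ahd => [|a1 a']; [exists p.+1, [::]|exists a1, (rcons a' p.+1)].
have [ha hp] : belast a1 a' = ahd /\ last a1 a' = p.+1.
  by have := lastI a1 a'; rewrite -aE => /rcons_inj [-> ->].
have [hb hq] : belast b1 b' = bhd /\ last b1 b' = q.+1.
  by have := lastI b1 b'; rewrite -bE => /rcons_inj [-> ->].
have sa : (sumn ahd + p.+1 = a1 + sumn a')%N by rewrite -sumn_rcons aE.
pose n := (sumn ahd + p + (b1 + sumn b'))%N.
rewrite {1}/l_gen aE (_ : (sumn _ + sumn _)%N = n.+1); last first.
  by rewrite /n /= -sa addnS addSn.
rewrite [LHS]/= ha hp hb hq -aE; apply: funext => th.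
have n0 : p = 0%N -> n = (sumn ahd + (b1 + sumn b'))%N.
  by move=> p0; rewrite /n p0 addn0.
have nq : n = (sumn ahd + p.+1 + (sumn bhd + q))%N.
  by rewrite /n -sb addnS addnS addnS.
congr (_ + _).
  rewrite /l_gen !sumn_rcons /= -/n eqSS; clearbody n; case: eqP => //= p0.
  by rewrite p0 in n0 *; rewrite n0 // addnA.
by rewrite /l_gen !sumn_rcons nq eqSS; case: eqP => //= ->; rewrite addn0.
Qed.

End Polylog.

(* omega_12 <-> omega_45 and omega_23 <-> omega_34. *)
Definition gen5_swap (e : gen5) : gen5 :=
  match e with
  | g45 => g12 | g34 => g23 | g24 => g24 | g12 => g45 | g23 => g34
  end.

Definition lxy : seq nat -> seq nat -> barfun := l_gen omega.
Definition lyx : seq nat -> seq nat -> barfun := l_gen (omega \o gen5_swap).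

(* The class in the completed U(p5) of a series in the five generators. *)
Definition gen5_series (th : series k gen5) : Up5 k :=
  pi_env (@p5_rel k) (subst (fun e => letter (gen5_p5 e)) th).

(* The functional on the completed U(p5) induced by l, computed on some series
   in the five generators representing z; by bar_evalE the choice does not
   matter when l is integrable.  Such a series exists whenever 2 is invertible,
   the five generators being then a basis of the degree one part of p5, so the
   default value 0 of xget is not used in characteristic zero. *)
Definition bar_eval (l : barfun) (z : Up5 k) : k :=
  l (xget 0 [set th | gen5_series th = z]%classic).

Definition integrable (l : barfun) : Prop :=
  forall th th', gen5_series th = gen5_series th' -> l th = l th'.

Lemma bar_evalE l th : integrable l -> bar_eval l (gen5_series th) = l th.
Proof.
move=> hl; apply: hl.
exact: (@xgetI _ 0 [set th' | gen5_series th' = gen5_series th]%classic).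
Qed.

End Bar.

Definition is_index (a : seq nat) : bool := (a != [::]) && all (leq 1) a.

(* Main.v *)
Require Import Defs.
From mathcomp Require Import all_boot all_order all_algebra.
From mathcomp Require Import boolp ring.
Set Implicit Arguments.
Unset Strict Implicit.
Unset Printing Implicit Defensive.
Import GRing.Theory.
Local Open Scope ring_scope.

(** The four conditions are four disguises of a single identity between series,
    [harm 0 psi = harm_correction psi].  Write x0 and x1 for the letters [false]
    and [true].  For a word w ending in x1, [harm n f w] is the value of f on
    the harmonic (quasi-shuffle) product of w with the one-block word x0^n x1,
    merged blocks counting with sign - 1, and [harm_correction psi] lives on the
    powers of x0 and of x1, where it is, up to sign, the depth one part of psi.

    What moves between the disguises is that a Lie series vanishes on the
    shuffle of a letter with a nonempty word ([ins_lie]); as psi has no linear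
    part, this says [ins c psi = 0].  The reduced coaction doubles one letter of a word at a
    time, so mu psi plus its boundary terms differs from [harm 0 psi] exactly by
    the insertion of x0 before each letter ([mu_harm]); the series r_psi
    contributes the correction, because word reversal relates the coefficients
    of x0^m x1 and of x1 x0^m ([lie_rev]).  Pulling mu back along the
    involution x0 |-> - x0 - x1 replaces the doubling of a letter by another
    one-letter substitution, which differs from [harm 0] by the insertion of x0
    after each letter; this handles the equation for eta
    ([substituted_coactionP]).

    For the polylogarithmic functionals, an index is encoded by its word w and
    b1 = n + 1, and the bar element becomes, up to sign, a functional [li w n]
    with a one-letter recursion ([l_gen_li]).  Its values on the class of
    alpha(psi) make sense because it is flat ([li_flat]): applied to a product
    p q h with p and q linear, it is symmetric in p and q as soon as p and q
    satisfy four equations dual to the quadratic relations of p5.  The sum of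
    the five terms of alpha(psi) is then [harm n psi w] minus a correction
    ([li_alpha]); a shuffle of x1 with w also appears, and vanishes on psi.
    The exchange of x12 with x45 and of x23 with x34 maps alpha(psi) to its
    opposite, which identifies the two families of functionals
    ([li_swap_alpha]).

    It remains to pass from all n and words ending in x1 to n = 0 and all words
    ([harm_correctionP]).  Inserting x0 in all positions is a derivation that
    raises n in the harmonic product ([harm_ins]); on psi it gives
    (n + 1) [harm n.+1 psi] = - [ins false (harm n psi)].  In characteristic
    zero this recovers every n from n = 0, and conversely moves trailing letters
    x0 towards the front, one at a time. *)

(** * Word operators on series *)

Section WordOperators.
Variables (k : comNzRingType) (X : choiceType).
Implicit Types (f g : series k X) (a c : X) (w : seq X).

Lemma dRE c f w : dR c f w = f (c :: w). Proof. by []. Qed.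

Lemma dR_mul c f g : dR c (f * g) = f [::] *: dR c g + dR c f * g.
Proof. exact: dR_smul. Qed.

(** The pairing of f with the shuffle product of the letter a and the word w:
    a is inserted in all size w + 1 positions. *)
Fixpoint ins a f w {struct w} : k :=
  if w is c :: w' then f [:: a, c & w'] + ins a (dR c f) w' else f [:: a].

(** Sum over the positions of w of the coefficient of f at w with the letter c
    in that position replaced by a combination of words.  The combination is
    given dually: [R c f v] is the value of f on that combination followed
    by v. *)
Fixpoint repl (R : X -> series k X -> series k X) f w {struct w} : k :=
  if w is c :: w' then R c f w' + repl R (dR c f) w' else 0.

Lemma insD a f g w : ins a (f + g) w = ins a f w + ins a g w.
Proof. by elim: w f g => //= c w IH f g; rewrite (IH (dR c f)) saddE addrACA. Qed.

Lemma insZ a b f w : ins a (b *: f) w = b * ins a f w.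
Proof. by elim: w f => //= c w IH f; rewrite (IH (dR c f)) sscaleE mulrDr. Qed.

Lemma insB a f g w : ins a (f - g) w = ins a f w - ins a g w.
Proof. by rewrite -scaleN1r insD insZ mulN1r. Qed.

(** Shuffling with one letter is dual to a derivation of the concatenation
    product. *)
Lemma ins_mul a f g :
  ins a (f * g) = (ins a f : series k X) * g + f * (ins a g : series k X).
Proof.
apply: funext => w; rewrite saddE; elim: w f g => [|c w IH] f g.
  by rewrite /= smul_consE !smul_nilE /= dRE addrC.
have dRins h : dR c (ins a h) = dR c (dR a h) + ins a (dR c h) by [].
rewrite [LHS]/= !smul_consE /= dRins mulrDl !saddE dR_mul insD insZ IH dRE.
ring.
Qed.

Lemma ins_local a f g w :
  (forall v, size v = (size w).+1 -> f v = g v) -> ins a f w = ins a g w.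
Proof.
elim: w f g => /= [|c w IH] f g fg; first exact: fg.
by rewrite fg // (IH (dR c f) (dR c g)) // => v vs; apply: fg; rewrite /= vs.
Qed.

(** A derivation that sends the letters to scalars kills brackets, because
    scalars are central. *)
Lemma ins_lie_poly a f : lie_poly f -> ins a f = (f [:: a])%:A :> series k X.
Proof.
have insL w b : ins a (letter b : series k X) w = (w == [::])%:R * (a == b)%:R.
  case: w => [|c w] /=; first by rewrite mul1r /letter eqseq_cons andbT.
  rewrite mul0r /letter eqseq_cons andbF add0r.
  transitivity (ins a (0 : series k X) w); last first.
    by rewrite -[X in ins _ X](scale0r 0) insZ mul0r.
  by apply: ins_local => -[|d v] //= _; rewrite /dR eqseq_cons andbF.
elim=> [|b|{}f g _ hf _ hg|b {}f _ hf|{}f g lf hf lg hg]; apply: funext => w.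
- by rewrite -[X in ins _ X](scale0r 0) insZ szeroE scale0r mul0r.
- by rewrite insL sscaleE soneE mulrC /letter eqseq_cons andbT.
- by rewrite insD hf hg scalerDl.
- by rewrite insZ hf sscaleE !sscaleE mulrA.
- have f0 := lie_series_const (lie_series_poly lf).
  have g0 := lie_series_const (lie_series_poly lg).
  rewrite /bracket insB !ins_mul hf hg -!scalerAl -!scalerAr !mul1r !mulr1.
  rewrite !saddE soppE !smul_consE !smul_nilE /= !f0 !g0 !sscaleE.
  by rewrite !mul0r !mulr0 !addr0 subr0 mul0r; ring.
Qed.

Lemma ins_lie a f : lie_series f -> ins a f = (f [:: a])%:A :> series k X.
Proof.
move=> lf; apply: funext => w.
rewrite (@ins_local a f (hcomp (size w).+1 f)); last first.
  by move=> v vs; rewrite /hcomp vs eqxx.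
rewrite ins_lie_poly //; case: w => [|c w]; first by rewrite /hcomp /=.
by rewrite !sscaleE soneE !mulr0.
Qed.

Lemma repl_add R R' f w :
  repl (fun c f => R c f + R' c f) f w = repl R f w + repl R' f w.
Proof. by elim: w f => [|c w IH] f /=; rewrite ?addr0 // IH saddE addrACA. Qed.

Lemma eq_repl R R' f w :
  (forall c f, R c f = R' c f) -> repl R f w = repl R' f w.
Proof. by move=> RR'; elim: w f => //= c w IH f; rewrite RR' IH. Qed.

Lemma replD R f g w : (forall c f g, R c (f + g) = R c f + R c g) ->
  repl R (f + g) w = repl R f w + repl R g w.
Proof.
move=> hR; elim: w f g => [|c w IH] f g /=; rewrite ?addr0 // hR saddE.
by rewrite (IH (dR c f)) addrACA.
Qed.

Lemma ins_repl_after a f w :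
  ins a f w = f (a :: w) + repl (fun c h => dR a (dR c h)) f w.
Proof.
by elim: w f => /= [|c w IH] f; rewrite ?addr0 // IH !dRE.
Qed.

Lemma ins_repl_before a f w :
  ins a f w = repl (fun c h => dR c (dR a h)) f w + f (rcons w a).
Proof.
by elim: w f => /= [|c w IH] f; rewrite ?add0r // IH !dRE addrA.
Qed.

Lemma ins_eq0 a f w :
  (forall u v, w = u ++ v -> f (u ++ a :: v) = 0) -> ins a f w = 0.
Proof.
elim: w f => /= [|c w IH] f h; first exact: (h [::] [::]).
rewrite (h [::] (c :: w)) // add0r; apply: IH => u v wE.
by apply: (h (c :: u) v); rewrite wE.
Qed.

Lemma ins_nseq a f m : ins a f (nseq m a) = m.+1%:R * f (nseq m.+1 a).
Proof.
elim: m f => [|m IH] f; first by rewrite /= mul1r.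
by rewrite /= IH dRE -[m.+2%:R]natr1; ring.
Qed.

(** Of the insertions of a in w c a^m, those to the right of c all give the word
    w c a^(m+1); the hypothesis kills the others. *)
Lemma ins_trailing a c f w m :
  (forall u v, w = u ++ v -> f (u ++ a :: v ++ c :: nseq m a) = 0) ->
  ins a f (w ++ c :: nseq m a) = m.+1%:R * f (w ++ c :: nseq m.+1 a).
Proof.
elim: w f => [|d w IH] f h.
  by rewrite /= (h [::] [::]) // add0r ins_nseq dRE.
rewrite /= (h [::] (d :: w)) // add0r IH ?dRE // => u v wE.
by apply: (h (d :: u) v); rewrite wE.
Qed.

End WordOperators.

(** * The harmonic product with one block *)

Section Harmonic.
Variable k : comNzRingType.
Local Notation A := (series k bool).
Implicit Types (f : A) (w : seq bool).

(** The word x0^n x1, the letter y_(n+1) of the harmonic algebra. *)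
Definition block n : seq bool := rcons (nseq n false) true.

Definition harm_letter n (c : bool) f : A :=
  fun v => if c then f (true :: block n ++ v) - f (block n.+1 ++ v) else 0.

(** Pairing with the harmonic product of y_(n+1) and w when w ends in x1: the
    block is put in front, or after some letter x1 of w, or merged, with
    sign - 1, into the block that ends with that letter. *)
Definition harm n f : A := fun w => f (block n ++ w) + repl (harm_letter n) f w.

Lemma blockS n w : block n.+1 ++ w = false :: block n ++ w. Proof. by []. Qed.

Lemma ins_block n f w : ins false f (block n ++ w) =
  n.+1%:R * f (block n.+1 ++ w) + ins false (fun v => f (block n ++ v)) w.
Proof.
elim: n f => [|n IH] f; first by rewrite /= mul1r.
by rewrite blockS /= IH !dRE -[n.+2%:R]natr1 /=; ring.
Qed.

Lemma harm_letterD n c f g :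
  harm_letter n c (f + g) = harm_letter n c f + harm_letter n c g.
Proof.
apply: funext => w; rewrite saddE /harm_letter; case: c; rewrite ?addr0 //.
by rewrite !saddE; ring.
Qed.

Lemma harm_letter_ins n c f w : harm_letter n c (ins false f) w =
  n.+1%:R * harm_letter n.+1 c f w + harm_letter n c (dR false f) w
  + ins false (harm_letter n c f) w.
Proof.
case: c; last first.
  rewrite /harm_letter !mulr0 !add0r -[RHS]/(ins false (0 : A) w).
  by rewrite -[X in ins _ X](scale0r 0) insZ mul0r.
transitivity (ins false f (true :: block n ++ w) - ins false f (block n.+1 ++ w)) => //.
rewrite -[X in ins _ X w]/(((fun v => f (true :: block n ++ v)) : A)
                           - ((fun v => f (block n.+1 ++ v)) : A)).
rewrite insB [ins false f (true :: _)]/= !ins_block /harm_letter !blockS !dRE.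
by rewrite -[n.+2%:R]natr1 /=; ring.
Qed.

Lemma repl_harm_ins n f w : repl (harm_letter n) (ins false f) w =
  n.+1%:R * repl (harm_letter n.+1) f w
  + ins false (repl (harm_letter n) f) w.
Proof.
elim: w f => [|c w IH] f /=.
  by rewrite mulr0 add0r /harm_letter addr0.
rewrite -[dR c (ins false f)]/(dR c (dR false f) + (ins false (dR c f) : A)).
rewrite replD; last by move=> *; exact: harm_letterD.
rewrite IH harm_letter_ins {3}/harm_letter add0r.
rewrite -[dR c (repl _ f)]/(harm_letter n c f + (repl (harm_letter n) (dR c f) : A)).
by rewrite insD; ring.
Qed.

(** Inserting x0 in a term of the harmonic product either falls outside the
    extra block, where it commutes with the product, or falls inside and
    lengthens the block; the latter happens in n + 1 positions. *)
Lemma harm_ins n f w : harm n (ins false f) w =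
  n.+1%:R * harm n.+1 f w + ins false (harm n f) w.
Proof.
rewrite /harm repl_harm_ins ins_block.
rewrite -[fun w => _]/(((fun v => f (block n ++ v)) : A) + (repl (harm_letter n) f : A)).
by rewrite insD; ring.
Qed.

End Harmonic.

(** * Reversal of words in Lie series *)

Section Antipode.
Variables (k : comNzRingType) (X : choiceType).
Implicit Types f g : series k X.

(** The antipode of the concatenation Hopf algebra. *)
Definition antipode f : series k X := fun w => (-1) ^+ size w * f (rev w).

Lemma antipode_mul f g : antipode (f * g) = antipode g * antipode f.
Proof.
apply: funext => w; rewrite /antipode !smulE size_rev mulr_sumr.
rewrite (reindex_inj rev_ord_inj) /=; apply: eq_bigr => i _.
have iw : (i <= size w)%N by rewrite -ltnS.
rewrite subSS take_rev drop_rev subKn // size_takel // size_drop mulrACA.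
by rewrite -exprD subnKC // [X in _ = _ * X]mulrC.
Qed.

(** An antimorphism equal to - 1 on letters is - 1 on brackets. *)
Lemma antipode_lie f : lie_series f -> antipode f = - f.
Proof.
move=> lf; apply: funext => w; rewrite soppE.
suff : antipode (hcomp (size w) f) w = - hcomp (size w) f w.
  by rewrite /antipode /hcomp size_rev eqxx.
have -> : antipode (hcomp (size w) f) = - hcomp (size w) f; last by [].
elim: (lf (size w)) => [|x|{w lf}f1 g _ hf _ hg|a {w lf}f1 _ hf|{w lf}f1 g _ hf _ hg].
- by apply: funext => v; rewrite /antipode soppE szeroE mulr0 oppr0.
- apply: funext => v; rewrite /antipode soppE /letter.
  case: v => [|y [|z v]]; first by rewrite mulr0 oppr0.
    by rewrite mulN1r.
  rewrite !eqseq_cons andbF oppr0; case: eqP => [/(congr1 size)|_].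
    by rewrite size_rev.
  by rewrite mulr0.
- rewrite opprD -hf -hg; apply: funext => v.
  by rewrite saddE /antipode saddE mulrDr.
- rewrite -scalerN -hf; apply: funext => v.
  by rewrite sscaleE /antipode sscaleE mulrCA.
- have antipodeB h h' : antipode (h - h') = antipode h - antipode h'.
    by apply: funext => v; rewrite saddE soppE /antipode saddE soppE mulrBr.
  by rewrite /bracket antipodeB !antipode_mul hf hg !mulrNN opprB.
Qed.

Lemma lie_rev f w : lie_series f -> f (rev w) = (-1) ^+ (size w).+1 * f w.
Proof.
move=> lf; have := congr1 (fun g : series k X => g (rev w)) (antipode_lie lf).
rewrite /antipode soppE size_rev revK exprS mulN1r mulNr => ->.
by rewrite opprK.
Qed.

End Antipode.

(** * Harmonic products and Lie series *)

Section LieHarmonic.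
Variable k : fieldType.
Hypothesis char0 : [pchar k] =i pred0.
Local Notation A := (series k bool).
Variable psi : A.
Hypothesis ins0 : ins false psi = 0 :> A.
Implicit Types (w v : seq bool).

Lemma natS_neq0 n : n.+1%:R != 0 :> k.
Proof. by have /(pcharf0P k) -> := char0. Qed.

(** The common right hand side of the equations, seen on psi: by reversal and
    skewness both branches are, up to sign, the coefficient of x1 x0^m. *)
Definition harm_correction : A := fun w =>
  if true \notin w then psi (true :: w)
  else if false \notin w then psi (rcons w false) else 0.

Lemma harm_rec n w :
  n.+1%:R * harm n.+1 psi w = - ins false (harm n psi) w.
Proof.
apply/eqP; rewrite -addr_eq0 -harm_ins ins0 /harm szeroE add0r; apply/eqP.
elim: w => //= c w IH; rewrite -[dR c 0]/(0 : A) IH addr0 /harm_letter.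
by case: c; rewrite ?szeroE ?subrr.
Qed.

Lemma harm_no_true n w : true \notin w -> harm n psi w = psi (block n ++ w).
Proof.
rewrite /harm => wF; suff -> : repl (harm_letter n) psi w = 0 by rewrite addr0.
elim: w psi wF => [|[] w IH] g //=.
by rewrite in_cons negb_or /harm_letter add0r => /IH.
Qed.

Lemma last_true w : true \in w ->
  exists u m, w = u ++ true :: nseq m false.
Proof.
elim/last_ind: w => // w [] IH; first by exists w, 0%N; rewrite cats1.
rewrite mem_rcons in_cons => /IH [u [m ->]]; exists u, m.+1.
by rewrite -addn1 nseqD -cat_cons catA cats1.
Qed.

(** The contribution of psi(x34, x23) to the pentagon defect, which only sees
    the indices (1, ..., 1) with b1 = 1. *)
Definition harm_defect n w : k :=
  if (n == 0%N) && (false \notin w) then psi (rcons w false) else 0.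

Lemma harm_correction_true w : true \in w -> harm_correction w = harm_defect 0 w.
Proof. by rewrite /harm_correction => ->. Qed.

Lemma harm_defect_false n w : false \in w -> harm_defect n w = 0.
Proof. by rewrite /harm_defect => ->; rewrite andbF. Qed.

(** From left to right, [harm_rec] expresses [harm n.+1] by values of [harm n]
    at words that contain both letters, where everything vanishes.  From right
    to left, the same relation expresses the value at a word with m + 1
    trailing letters x0 by values at words with m of them. *)
Lemma harm_correctionP : harm 0 psi = harm_correction <->
  forall n w, harm n psi (rcons w true) = harm_defect n (rcons w true).
Proof.
split=> [H | H].
  suff h n w : true \in w -> harm n psi w = harm_defect n w.
    by move=> n w; apply: h; rewrite mem_rcons mem_head.
  elim: n w => [|n IH] w wT; first by rewrite H harm_correction_true.
  apply: (mulfI (natS_neq0 n)); rewrite harm_rec mulr0 ins_eq0 ?oppr0 // => u v wE.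
  rewrite IH; first by rewrite harm_defect_false // mem_cat mem_head orbT.
  by move: wT; rewrite wE !mem_cat in_cons.
have h m : forall n w, harm n psi (w ++ true :: nseq m false) =
                       harm_defect n (w ++ true :: nseq m false).
  elim: m => [|m IH] n w; first by rewrite cats1.
  have E : ins false (harm n psi) (w ++ true :: nseq m false) = 0.
    by rewrite -[LHS]opprK -harm_rec IH /harm_defect mulr0 oppr0.
  rewrite harm_defect_false ?mem_cat ?in_cons ?orbT //.
  apply: (mulfI (natS_neq0 m)); rewrite mulr0 -E; apply/esym/ins_trailing => u v wE.
  by rewrite -cat_cons catA IH harm_defect_false // !mem_cat mem_head orbT.
apply: funext => w; case: (boolP (true \in w)) => [wT|wF].
  by have [u [m wE]] := last_true wT; rewrite harm_correction_true // wE h.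
by rewrite harm_no_true // /harm_correction wF.
Qed.

End LieHarmonic.

(** * Linear substitutions *)

Section Substitution.
Variables (k : comNzRingType).

Lemma smul_local (Y : choiceType) (u g h : series k Y) w : u [::] = 0 ->
  (forall v, (size v < size w)%N -> g v = h v) -> (u * g) w = (u * h) w.
Proof.
move=> u0 gh; rewrite !smulE; apply: eq_bigr => -[[|i] ilt] _ /=.
  by rewrite take0 u0 !mul0r.
rewrite gh // size_drop; case: w ilt {gh} => //= y w _.
by rewrite subSS ltnS leq_subr.
Qed.

(** The recursion determines F because s x has no constant term, so that the
    right hand side only involves shorter words; two composites of
    substitutions are compared through it. *)
Lemma subst_uniq (X : finType) (Y : choiceType) (s : X -> series k Y) F f :
  (forall x, s x [::] = 0) ->
  (forall g, F g = (g [::])%:A + \sum_x s x * F (dR x g)) -> F f = subst s f.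
Proof.
move=> s0 hF; apply: funext => w; have [n] := ubnP (size w).
elim: n w f => // n IH w f; rewrite ltnS => wn.
rewrite hF subst_rec // !saddE !ssumE; congr (_ + _); apply: eq_bigr => x _.
by apply: smul_local => // v vw; apply: IH; apply: leq_trans vw wn.
Qed.

Lemma subst_sum (X : finType) (Y : choiceType) (s : X -> series k Y) I (r : seq I)
    (P : pred I) (F : I -> series k X) :
  subst s (\sum_(i <- r | P i) F i) = \sum_(i <- r | P i) subst s (F i).
Proof. exact: (big_morph (subst s) (substD s) (subst0 s)). Qed.

Lemma subst_comp (X Y : finType) (Z : choiceType) (s : X -> series k Y)
    (t : Y -> series k Z) f :
  (forall x, s x [::] = 0) -> (forall y, t y [::] = 0) ->
  subst t (subst s f) = subst (fun x => subst t (s x)) f.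
Proof.
move=> s0 t0.
have scalar (b : k) : subst t b%:A = b%:A.
  rewrite subst_rec // sscaleE soneE eqxx mulr1 big1 ?addr0 // => x _.
  rewrite (_ : dR x _ = 0) ?subst0 ?mulr0 //; apply: funext => w.
  by rewrite /dR sscaleE soneE mulr0.
have st0 x : subst t (s x) [::] = 0.
  rewrite subst_rec // saddE ssumE sscaleE soneE s0 mul0r add0r.
  by rewrite big1 // => y _; rewrite smul_nilE t0 mul0r.
apply: (subst_uniq (F := fun f => subst t (subst s f))) => // g.
rewrite (subst_rec s0 g) substD scalar subst_sum; congr (_ + _).
by apply: eq_bigr => x _; rewrite substM.
Qed.

Lemma letter_mulE (Y : choiceType) (x : Y) (g : series k Y) w :
  (letter x * g) w = if w is c :: w' then (c == x)%:R * g w' else 0.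
Proof.
case: w => [|c w]; first by rewrite smul_nilE mul0r.
rewrite smul_consE mul0r add0r (_ : dR c _ = (c == x)%:R%:A).
  by rewrite -scalerAl mul1r sscaleE.
apply: funext => v; rewrite /dR /letter sscaleE soneE eqseq_cons.
by rewrite -natrM mulnb.
Qed.

Lemma subst_id (X : finType) (f : series k X) : subst letter f = f.
Proof.
apply/esym/(subst_uniq (F := id)) => // g; apply: funext => w.
rewrite saddE ssumE sscaleE soneE.
under eq_bigr do rewrite letter_mulE.
case: w => [|c w] /=; first by rewrite mulr1 big1 ?addr0.
rewrite mulr0 add0r (bigD1 c) //= eqxx mul1r big1 ?addr0 // => x xc.
by rewrite eq_sym (negPf xc) mul0r.
Qed.

Definition linear_form (Y : choiceType) (u : series k Y) : Prop :=
  forall w, size w != 1%N -> u w = 0.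

Lemma dR_linear_form (Y : choiceType) (u : series k Y) c :
  linear_form u -> dR c u = (u [:: c])%:A.
Proof.
move=> lu; apply: funext => -[|d w]; first by rewrite sscaleE mulr1.
by rewrite sscaleE mulr0; apply: lu.
Qed.

Lemma linear_form_letter (Y : choiceType) (x : Y) :
  linear_form (letter x : series k Y).
Proof. by move=> w w1; rewrite /letter; case: eqP => // wE; rewrite wE in w1. Qed.

Lemma linear_formD (Y : choiceType) (u v : series k Y) :
  linear_form u -> linear_form v -> linear_form (u + v).
Proof. by move=> lu lv w w1; rewrite saddE lu ?lv ?addr0. Qed.

Lemma linear_formN (Y : choiceType) (u : series k Y) :
  linear_form u -> linear_form (- u).
Proof. by move=> lu w w1; rewrite soppE lu ?oppr0. Qed.

Lemma linear_form0 (Y : choiceType) : linear_form (0 : series k Y).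
Proof. by []. Qed.

Lemma dR_linear_mul (Y : choiceType) (u g : series k Y) c : linear_form u ->
  dR c (u * g) = u [:: c] *: g.
Proof.
by move=> lu; rewrite dR_mul lu // scale0r add0r dR_linear_form // -scalerAl mul1r.
Qed.

(** For a linear substitution the first letter can be peeled off, which turns
    statements about substituted series into inductions on words. *)
Lemma dR_subst (X : finType) (Y : choiceType) (s : X -> series k Y) c f :
  (forall x, linear_form (s x)) ->
  dR c (subst s f) = subst s (\sum_x s x [:: c] *: dR x f).
Proof.
move=> ls; rewrite subst_rec; last by move=> x; apply: ls.
rewrite subst_sum; apply: funext => w; rewrite dRE saddE sscaleE soneE mulr0 add0r.
rewrite !ssumE; apply: eq_bigr => x _.
by rewrite -[LHS]/(dR c _ w) dR_linear_mul // substZ.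
Qed.

Lemma subst_nil (X : finType) (Y : choiceType) (s : X -> series k Y) f :
  (forall x, linear_form (s x)) -> subst s f [::] = f [::].
Proof.
move=> ls; rewrite subst_rec; last by move=> x; apply: ls.
rewrite saddE ssumE sscaleE mulr1 big1 ?addr0 // => x _.
by rewrite smul_nilE ls // mul0r.
Qed.

End Substitution.

Section TwoLetterSubstitution.
Variable k : comNzRingType.
Local Notation A := (series k bool).
Implicit Types (f : A) (w : seq bool).

Lemma dR_subst2 (Y : choiceType) (u v : series k Y) c f :
  linear_form u -> linear_form v ->
  dR c (subst2 u v f) = subst2 u v (v [:: c] *: dR true f + u [:: c] *: dR false f).
Proof. by move=> lu lv; rewrite dR_subst ?big_bool //; case. Qed.

Lemma subst2_nil (Y : choiceType) (u v : series k Y) f :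
  linear_form u -> linear_form v -> subst2 u v f [::] = f [::].
Proof. by move=> lu lv; rewrite /subst2 subst_nil //; case. Qed.

Lemma subst2_comp (Y : finType) (Z : choiceType) (u v : series k Y)
    (t : Y -> series k Z) f : linear_form u -> linear_form v ->
  (forall y, t y [::] = 0) ->
  subst t (subst2 u v f) = subst2 (subst t u) (subst t v) f.
Proof.
move=> lu lv t0; rewrite /subst2 subst_comp //; last by case; [apply: lv|apply: lu].
by congr subst; apply: funext; case.
Qed.

Lemma subst2_x0 (Y : choiceType) (u v : series k Y) : linear_form u -> linear_form v ->
  subst2 u v x0 = u.
Proof. by move=> lu lv; rewrite /subst2 subst_letter //; case; [apply: lv|apply: lu]. Qed.

Lemma subst2_x1 (Y : choiceType) (u v : series k Y) : linear_form u -> linear_form v ->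
  subst2 u v x1 = v.
Proof. by move=> lu lv; rewrite /subst2 subst_letter //; case; [apply: lv|apply: lu]. Qed.

Lemma linear_x0 : linear_form (x0 : A). Proof. exact: linear_form_letter. Qed.
Lemma linear_x1 : linear_form (x1 : A). Proof. exact: linear_form_letter. Qed.
Hint Resolve linear_x0 linear_x1 linear_formD linear_formN linear_form0 : core.

Lemma subst2_x0_0 f w : subst2 x0 0 f w = if true \in w then 0 else f w.
Proof.
elim: w f => [|c w IH] f; first by rewrite subst2_nil.
rewrite -[LHS]/(dR c _ w) dR_subst2 // szeroE scale0r add0r /x0 /letter.
case: c => /=; first by rewrite scale0r /subst2 subst0.
by rewrite scale1r IH.
Qed.

Lemma subst2_Nx1_0 f w : subst2 (- x1) 0 f w =
  if false \in w then 0 else (-1) ^+ size w * f (nseq (size w) false).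
Proof.
elim: w f => [|c w IH] f; first by rewrite subst2_nil ?mul1r //; auto.
rewrite -[LHS]/(dR c _ w) dR_subst2; auto.
rewrite szeroE scale0r add0r soppE /x1 /letter.
case: c => /=; last by rewrite oppr0 scale0r /subst2 subst0.
rewrite /subst2 substZ -/(subst2 _ _ _) sscaleE IH exprS in_cons /=.
by case: ifP; rewrite ?mulr0 ?mulrA.
Qed.

Lemma subst2_swap f w : subst2 x1 x0 f w = f (map negb w).
Proof.
elim: w f => [|c w IH] f; first by rewrite subst2_nil.
rewrite -[LHS]/(dR c _ w) dR_subst2 // /x0 /x1 /letter.
by case: c; rewrite /= ?scale0r ?scale1r ?add0r ?addr0 IH.
Qed.

End TwoLetterSubstitution.
#[global] Hint Resolve linear_x0 linear_x1 linear_formD linear_formN linear_form0 : core.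

(** * The reduced coaction as a word operator *)

Section Coaction.
Variable k : comNzRingType.
Local Notation A := (series k bool).
Implicit Types (f : A) (w : seq bool).

Lemma word_seriesE v w : word_series k v w = (w == v)%:R.
Proof.
elim: v w => [|c v IH] w; first by rewrite /word_series big_nil.
rewrite /word_series big_cons letter_mulE; case: w => // d w.
by rewrite -/(word_series k v) IH eqseq_cons -mulnb natrM.
Qed.

Lemma mu_word_cons c d v w : mu_word k [:: c, d & v] w =
  if w is e :: w' then
    (e == c)%:R * ((d :: v == e :: w')%:R + mu_word k (d :: v) w')
  else 0.
Proof.
have ws_cons b u : word_series k (b :: u) = letter b * word_series k u.
  by rewrite /word_series big_cons.
rewrite /mu_word [size _]/= big_ord_recl /= drop0 saddE.
rewrite -[word_series k [::]]/(\prod_(x <- [::]) letter x) big_nil mul1r.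
under [X in _ + X w]eq_bigr => i _ do rewrite ws_cons -!mulrA.
rewrite -mulr_sumr letter_mulE /odot.
case: w => [|e w].
  by rewrite addr0; case: ifP => _; rewrite ?mul0r // letter_mulE.
rewrite mulrDr; congr (_ + _).
  case: (eqVneq c d) => [<-|cd].
    rewrite letter_mulE word_seriesE eqseq_cons (eq_sym c) (eq_sym v).
    by case: (e == c); rewrite ?mul0r ?mul1r ?andTb.
  rewrite (mul0r (word_series k v)) szeroE eqseq_cons (eq_sym d).
  case: (eqVneq e c) => [->|]; rewrite ?mul0r //.
  by rewrite (negPf cd) mulr0.
by congr (_ * _); rewrite !ssumE; apply: eq_bigr => i _; rewrite mulrA.
Qed.

(** The transpose of x_i . x_j |-> delta_ij x_i doubles a letter. *)
Lemma mu_repl f : mu f = repl (fun c h => dR c (dR c h)) f.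
Proof.
apply: funext => w; elim: w f => [|c w IH] f.
  rewrite /mu big1 // => v _.
  by rewrite /mu_word size_tuple big_ord0 mulr0.
rewrite /= -IH !dRE /mu.
have consE n (F : seq bool -> k) :
    \sum_(v : n.+1.-tuple bool) F v = \sum_b \sum_(v : n.-tuple bool) F (b :: v).
  rewrite pair_bigA /= (reindex (fun p : bool * n.-tuple bool => [tuple of p.1 :: p.2])) //=.
  exists (fun t : n.+1.-tuple bool => (thead t, [tuple of behead t])).
    by move=> [x t] _ /=; congr pair; apply: val_inj.
  by move=> t _; rewrite [RHS]tuple_eta; apply: val_inj.
rewrite (consE _ (fun v => f v * mu_word k v (c :: w))) (bigD1 c) //=.
have muE b (v : (size w).+1.-tuple bool) : mu_word k (b :: v) (c :: w) =
    (c == b)%:R * ((v == c :: w :> seq bool)%:R + mu_word k v w).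
  by case: v => -[|d v] // vs; rewrite [tval _]/= mu_word_cons.
rewrite [X in _ + X]big1 ?addr0 => [|b bc]; last first.
  rewrite big1 // => v _; rewrite muE eq_sym (negPf bc) mul0r mulr0 //.
under eq_bigr => v _ do rewrite muE eqxx mul1r mulrDr.
rewrite big_split /=; congr (_ + _).
(* The only word of [mu] that starts by merging two letters is c c w. *)
rewrite (bigD1 (cons_tuple c (in_tuple w))) //= eqxx mulr1 big1 ?addr0 // => v.
by rewrite -val_eqE /= => /negPf ->; rewrite mulr0.
Qed.

End Coaction.

(** * The two coaction equations *)

Section CoactionEquations.
Variable k : fieldType.
Local Notation A := (series k bool).
Variable psi : A.
Hypothesis psi_lie : lie_series psi.
Hypothesis psi_x0 : subst2 x0 0 psi = 0.
Hypothesis psi_skew : psi = - subst2 x1 x0 psi.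
Implicit Types (f : A) (w : seq bool).

Lemma psi_map_negb w : psi (map negb w) = - psi w.
Proof.
have := congr1 (fun f : A => f w) psi_skew; rewrite soppE subst2_swap => ->.
by rewrite opprK.
Qed.

Lemma psi_no_true w : true \notin w -> psi w = 0.
Proof.
move=> wF; have := congr1 (fun f : A => f w) psi_x0.
by rewrite subst2_x0_0 (negPf wF).
Qed.

Lemma psi_letter c : psi [:: c] = 0.
Proof.
have z : psi [:: false] = 0 by apply: psi_no_true.
by case: c => //; rewrite -[[:: true]]/(map negb [:: false]) psi_map_negb z oppr0.
Qed.

Lemma ins_psi c : ins c psi = 0 :> A.
Proof. by rewrite ins_lie // psi_letter scale0r. Qed.

(** The words x0^m x1 and x1 x0^m are mirror images. *)
Lemma psi_depth1 m :
  psi (rcons (nseq m false) true) = (-1) ^+ m * psi (true :: nseq m false).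
Proof.
have rev_nseq (c : bool) : rev (nseq m c) = nseq m c.
  by elim: m => // m IH; rewrite -[in RHS]addn1 nseqD /= rev_cons IH cats1.
rewrite -[X in rcons X _](rev_nseq false) -rev_cons lie_rev //= size_nseq.
by rewrite !exprS mulN1r mulN1r opprK.
Qed.

Lemma psi_depth1_dual m :
  psi (rcons (nseq m true) false) = - ((-1) ^+ m * psi (true :: nseq m false)).
Proof.
by rewrite -psi_depth1 -psi_map_negb map_rcons map_nseq.
Qed.

Lemma no_true_nseq w : true \notin w -> w = nseq (size w) false.
Proof. by elim: w => // -[|] w IH //=; rewrite in_cons => /IH {1}->. Qed.

Lemma no_false_nseq w : false \notin w -> w = nseq (size w) true.
Proof. by elim: w => // -[|] w IH //=; rewrite in_cons => /IH {1}->. Qed.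

Lemma harm_correctionE w : harm_correction psi w =
  if true \notin w then psi (true :: w)
  else if false \notin w then - ((-1) ^+ size w * psi (true :: nseq (size w) false))
  else 0.
Proof.
rewrite /harm_correction; case: ifP => // _; case: ifP => // wT.
by rewrite {1}(no_false_nseq wT) psi_depth1_dual.
Qed.

Lemma harm0E w : harm 0 psi w =
  psi (true :: w) + repl (harm_letter 0) psi w.
Proof. by []. Qed.

(** Subtract the sum of all insertions of x0 in w, which is zero: doubling x0 is
    an insertion before x0, and the insertion at the end is the left boundary
    term, so that only the terms of [harm] at the letters x1 survive. *)
Lemma mu_harm w : mu psi w + psi (rcons w false) + psi (true :: w) = harm 0 psi w.
Proof.
have := congr1 (fun f : A => f w) (ins_psi false).
rewrite /= ins_repl_before szeroE mu_repl harm0E => h.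
rewrite (@eq_repl _ _ _ (fun c h => harm_letter 0 c h + dR c (dR false h))) ?repl_add.
  by rewrite -[_ + _ + psi (rcons w false)]addrA h addr0 addrC.
move=> c g; apply: funext => v; rewrite saddE /harm_letter !dRE.
by case: c; rewrite ?add0r //= subrK.
Qed.

Lemma letter_expE b m w : ((letter b : A) ^+ m) w = (w == nseq m b)%:R.
Proof.
elim: m w => [|m IH] w; first by rewrite expr0 soneE.
rewrite exprS letter_mulE; case: w => // c w.
by rewrite IH /= eqseq_cons -mulnb natrM.
Qed.

Lemma r_sum b (a : k) w : r_ psi (a *: letter b) w =
  if (~~ b \in w) || (w == [::]) then 0
  else a ^+ size w * psi (rcons (nseq (size w) false) true).
Proof.
rewrite /r_ /coef.
under eq_bigr => l _ do rewrite exprZn sscaleE letter_expE.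
case: ifP => [/orP[wb|/eqP ->]|/negbT]; last first.
- rewrite negb_or => /andP[wb w0]; have ws : w = nseq (size w) b.
    by case: b wb => [/no_false_nseq|/no_true_nseq].
  case E: (size w) => [|n]; first by move: w0; rewrite -size_eq0 E.
  rewrite big_ord_recr /= big1 ?add0r => [|l _].
    by rewrite ws E eqxx mulr1 mulrC.
  rewrite ws E; case: eqP => [/(congr1 size)|]; rewrite ?mulr0 //.
  by rewrite /= !size_nseq => -[ln]; have := ltn_ord l; rewrite -ln ltnn.
- by rewrite big_ord0.
rewrite big1 // => l _; case: eqP => [wE|]; rewrite ?mulr0 //.
have : ~~ b \in nseq l.+1 b by rewrite -wE.
by rewrite mem_nseq; case: (b).
Qed.

(** By [mu_harm], the boundary terms of the equation turn mu psi into
    [harm 0 psi], and the two r-series are the correction. *)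
Lemma reduced_coactionP :
  reduced_coaction_eq psi <-> harm 0 psi = harm_correction psi.
Proof.
have r1 w : r_ psi x1 w = if (false \in w) || (w == [::]) then 0
    else psi (rcons (nseq (size w) false) true).
  by rewrite -[x1]scale1r r_sum expr1n mul1r.
have r0 w : r_ psi (- x0) w = if (true \in w) || (w == [::]) then 0
    else psi (true :: w).
  rewrite -scaleN1r r_sum; case: ifP => // /negbT; rewrite negb_or => /andP[wF _].
  by rewrite psi_depth1 mulrA -exprD addnn -mul2n exprM sqrrN !expr1n mul1r -no_true_nseq.
have bound w : - r_ psi x1 w + r_ psi (- x0) w = harm_correction psi w.
  rewrite r1 r0 harm_correctionE; case: w => [|c w].
    by rewrite /= psi_letter oppr0 addr0.
  rewrite !orbF; case: (boolP (true \in _)) => wT; case: (boolP (false \in _)) => wF.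
  - by rewrite oppr0 addr0.
  - by rewrite addr0 psi_depth1.
  - by rewrite oppr0 add0r.
  - by move: wT wF; rewrite !in_cons; case: c.
split=> H; apply: funext => w.
  rewrite -mu_harm -bound H !saddE !soppE /dL /dR; ring.
have := congr1 (fun f : A => f w) H; rewrite -bound -mu_harm => h.
rewrite !saddE !soppE -h /dL /dR; ring.
Qed.

(** The substitution that sends psi to eta. *)
Definition involution_subst f : A := subst2 (- x0 - x1) x1 f.
Local Notation S := involution_subst.

Lemma involution_false f w : S f (false :: w) = - S (dR false f) w.
Proof.
rewrite -[LHS]/(dR false _ w) dR_subst2; auto.
by rewrite saddE !soppE /x0 /x1 /letter /= scale0r add0r oppr0 addr0 scaleN1r /subst2 substN.
Qed.

Lemma involution_true f w : S f (true :: w) = S (dR true f - dR false f) w.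
Proof.
rewrite -[LHS]/(dR true _ w) dR_subst2; auto.
by rewrite saddE !soppE /x0 /x1 /letter /= scale1r oppr0 add0r scaleN1r.
Qed.

Lemma involution_nil f : S f [::] = f [::].
Proof. by rewrite /S subst2_nil; auto. Qed.

Lemma involutionB f g : S (f - g) = S f - S g. Proof. exact: substB. Qed.

Lemma subst2_involution (u v : A) f : linear_form u -> linear_form v ->
  subst2 u v (S f) = subst2 (- u - v) v f.
Proof.
move=> lu lv; rewrite {1}/subst2 subst2_comp; auto.
  by rewrite substB substN -/(subst2 u v x0) -/(subst2 u v x1) subst2_x0 // subst2_x1.
by case; [apply: lv|apply: lu].
Qed.

Lemma involution_subst2 (u v : A) f : linear_form u -> linear_form v ->
  S (subst2 u v f) = subst2 (S u) (S v) f.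
Proof.
move=> lu lv; rewrite {1}/S {1}/subst2 subst2_comp //.
by case; [|apply: linear_formD; auto].
Qed.

Lemma involution_x0 : S x0 = - x0 - x1.
Proof. by rewrite /S subst2_x0; auto. Qed.

Lemma involution_x1 : S x1 = x1.
Proof. by rewrite /S subst2_x1; auto. Qed.

Lemma involutionK f : S (S f) = f.
Proof.
rewrite {1}/S subst2_involution; auto; rewrite opprB opprK [_ + x0]addrC addrK.
rewrite -[RHS]subst_id /subst2; congr subst; apply: funext; by case.
Qed.

(** Letter doubling in the basis - x0, x1 - x0 of linear forms: with z and y for
    these forms, the coproduct of [mu] sends z to - zz and y to
    yy - yz - zy. *)
Definition coaction_letter (c : bool) f : A :=
  if c then dR true (dR true f) - dR true (dR false f) - dR false (dR true f)
  else - dR false (dR false f).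

Lemma mu_involution f : mu (S f) = S (repl coaction_letter f).
Proof.
rewrite mu_repl; apply: funext => w.
have dR_repl c g : dR c (repl coaction_letter g) =
  coaction_letter c g + (repl coaction_letter (dR c g) : A) by [].
have lD c g h : coaction_letter c (g + h) = coaction_letter c g + coaction_letter c h.
  by apply: funext => v; case: c; rewrite /coaction_letter /= !(saddE, soppE, dRE); ring.
have lN c g : coaction_letter c (- g) = - coaction_letter c g.
  by apply: funext => v; case: c; rewrite /coaction_letter /= !(saddE, soppE, dRE); ring.
have repl0 v : repl coaction_letter 0 v = 0.
  elim: v => //= c v IH; rewrite -[dR c 0]/(0 : A) IH addr0.
  by case: c; rewrite /coaction_letter /= !(saddE, soppE, dRE) !szeroE; ring.
have replN g : repl coaction_letter (- g) = - (repl coaction_letter g : A) :> A.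
  apply: funext => v; apply/eqP; rewrite soppE -addr_eq0 -replD // addrC subrr.
  by rewrite repl0.
have replD' g h : repl coaction_letter (g + h) =
    (repl coaction_letter g : A) + (repl coaction_letter h : A) :> A.
  by apply: funext => v; rewrite replD.
elim: w f => [|[] w IH] f; first by rewrite involution_nil.
  have dRS g : dR true (S g) = S (dR true g - dR false g).
    by apply: funext => v; exact: involution_true.
  rewrite involution_true /= !dRS IH -saddE -[S _ + _]/(_ + _) /S -substD.
  congr (subst _ _ w).
  rewrite !dR_repl replD' replN /coaction_letter.
  apply: funext => v; rewrite !(saddE, soppE, dRE); ring.
have dRS g : dR false (S g) = S (- dR false g).
  by apply: funext => v; rewrite dRE involution_false /S /subst2 substN.
rewrite involution_false /= !dRS IH -soppE -saddE /S /subst2 -substN -substD.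
congr (subst _ _ w).
rewrite !dR_repl replN /coaction_letter.
apply: funext => v; rewrite !(saddE, soppE, dRE); ring.
Qed.

(** The difference is the sum of the insertions of x0 after each letter. *)
Lemma repl_coaction_letter w :
  repl coaction_letter psi w = harm 0 psi w - (dR true psi - dR false psi) w.
Proof.
have := congr1 (fun f : A => f w) (ins_psi false).
rewrite /= ins_repl_after szeroE addrC => /eqP; rewrite addr_eq0 => /eqP h.
rewrite harm0E.
have -> : repl (harm_letter 0) psi w = repl coaction_letter psi w
    + repl (fun c h => dR false (dR c h)) psi w.
  rewrite -repl_add; apply: eq_repl => c g; apply: funext => v.
  by rewrite /harm_letter /coaction_letter; case: c; rewrite /= !(saddE, soppE, dRE) /=; ring.
by rewrite h !(saddE, soppE, dRE); ring.
Qed.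

(** All terms are images under the involution, which can be cancelled; the two
    substitutions that kill a letter only see the words x0^m and give the two
    halves of the correction. *)
Lemma substituted_coactionP :
  (mu (S psi) = subst2 (x0 + x1) 0 (dR true (S psi)) - dR true (S psi)
                - subst2 x1 0 (dR true (S psi)))
  <-> harm 0 psi = harm_correction psi.
Proof.
pose g := dR true psi - dR false psi.
have -> : dR true (S psi) = S g by apply: funext => w; exact: involution_true.
rewrite mu_involution !subst2_involution; auto; rewrite !subr0 opprD.
(* The composites send x0 to - x0 - x1, respectively to - x1, and x1 to 0. *)
have -> : subst2 (- x0 - x1) 0 g = S (subst2 x0 0 g).
  by rewrite involution_subst2 // involution_x0 [S 0]subst0.
have -> : subst2 (- x1) 0 g = S (subst2 (- x1) 0 g).
  rewrite involution_subst2; auto.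
  by rewrite [S (- x1)]substN [subst _ x1]involution_x1 [S 0]subst0.
rewrite -!involutionB.
have gE w : true \notin w -> g w = psi (true :: w).
  move=> wF; rewrite /g saddE soppE dRE (dRE false) (@psi_no_true (false :: w)) ?subr0 //.
have bound w : (subst2 x0 0 g - subst2 (- x1) 0 g) w = harm_correction psi w.
  rewrite saddE soppE subst2_x0_0 subst2_Nx1_0 harm_correctionE.
  case: w => [|c w]; first by rewrite /= mul1r subrr psi_letter.
  case: (boolP (true \in _)) => wT; case: (boolP (false \in _)) => wF.
  - by rewrite subr0.
  - by rewrite sub0r gE // mem_nseq andbF.
  - by rewrite subr0 gE.
  - by move: wT wF; rewrite !in_cons; case: c.
split=> [/(congr1 S)|] H.
  rewrite !involutionK in H; apply: funext => w; rewrite -bound.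
  have := congr1 (fun f : A => f w) H; rewrite repl_coaction_letter -/g => h.
  by rewrite -[LHS](subrK (g w)) h !saddE !soppE; ring.
congr S; apply: funext => w; rewrite repl_coaction_letter -/g H -bound.
by rewrite !saddE !soppE; ring.
Qed.

End CoactionEquations.

(** * Polylogarithmic functionals and their flatness *)

Section BarFunctionals.
Variable k : comNzRingType.
Local Notation B := (series k gen5).
Implicit Types (f g h p q r u : B) (l : barfun k) (al : Defs.form k).

Definition linear_fun l := forall a f g, l (a *: f + g) = a * l f + l g.

Definition pairing al p : k := \sum_e al e * p [:: e].

Lemma linear_fun0 l : linear_fun l -> l 0 = 0.
Proof. by move=> ll; rewrite -[X in l X](addNr (0 : B)) -scaleN1r ll mulN1r addNr. Qed.

Lemma linear_funD l f g : linear_fun l -> l (f + g) = l f + l g.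
Proof. by move=> ll; rewrite -[f in LHS]scale1r ll mul1r. Qed.

Lemma linear_funZ l a f : linear_fun l -> l (a *: f) = a * l f.
Proof. by move=> ll; rewrite -[X in l X]addr0 ll linear_fun0 // addr0. Qed.

Lemma linear_funB l f g : linear_fun l -> l (f - g) = l f - l g.
Proof. by move=> ll; rewrite addrC -scaleN1r ll mulN1r addrC. Qed.

Lemma linear_fun_sum l I (s : seq I) (F : I -> B) : linear_fun l ->
  l (\sum_(i <- s) F i) = \sum_(i <- s) l (F i).
Proof.
move=> ll; apply: (big_morph l) => [f g|]; [exact: linear_funD|exact: linear_fun0].
Qed.

Lemma bar_cons_linear al l : linear_fun l -> linear_fun (bar_cons al l).
Proof.
move=> ll a f g; rewrite /bar_cons mulr_sumr -big_split /=; apply: eq_bigr => e _.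
by rewrite -[dR e _]/(a *: dR e f + dR e g) ll; ring.
Qed.

Lemma bar_word_linear s : linear_fun (@bar_word k s).
Proof.
elim: s => [|al s IH]; last exact: bar_cons_linear.
by move=> a f g; rewrite /= /bar_nil /coef saddE sscaleE.
Qed.

Lemma bar_cons_mul al l p h : linear_fun l -> linear_form p ->
  bar_cons al l (p * h) = pairing al p * l h.
Proof.
move=> ll lp; rewrite /bar_cons /pairing mulr_suml; apply: eq_bigr => e _.
by rewrite dR_linear_mul // linear_funZ // mulrA.
Qed.

Lemma bar_cons_subst2 al l (u v : B) (f : series k bool) :
  linear_fun l -> linear_form u -> linear_form v ->
  bar_cons al l (subst2 u v f) = pairing al u * l (subst2 u v (dR false f))
                                + pairing al v * l (subst2 u v (dR true f)).
Proof.
move=> ll lu lv; rewrite /bar_cons /pairing !mulr_suml -big_split /=.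
apply: eq_bigr => e _; rewrite dR_subst2 // /subst2 substD !substZ.
by rewrite ll linear_funZ //; ring.
Qed.

Definition homogeneous N l := forall f, l f = l (hcomp N f).

Lemma bar_cons_homogeneous N al l :
  homogeneous N l -> homogeneous N.+1 (bar_cons al l).
Proof. by move=> hl f; apply: eq_bigr => e _; rewrite hl. Qed.

Lemma bar_word_homogeneous s : homogeneous (size s) (@bar_word k s).
Proof. by elim: s => // al s IH; exact: bar_cons_homogeneous. Qed.

Lemma pairingD al al' p : pairing (al + al') p = pairing al p + pairing al' p.
Proof. by rewrite /pairing -big_split; apply: eq_bigr => e _; rewrite ffunE mulrDl. Qed.

Lemma pairingB al al' p : pairing (al - al') p = pairing al p - pairing al' p.
Proof.
by rewrite /pairing -sumrB; apply: eq_bigr => e _; rewrite !ffunE mulrBl.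
Qed.

Section Polylogarithms.
Variable om : gen5 -> Defs.form k.
Implicit Types (w : seq bool) (n : nat).

Definition li_xy w : barfun k :=
  bar_word [seq if c then om g24 else om g12 + om g45 | c <- w].

(** The functional of the index whose word is w and of b1 = n + 1, without its
    sign.  In terms of words the recursion removes one letter, and the index
    obtained by moving b1 to the end of a is the word [block n ++ w']; all
    words are allowed, not only those of indices. *)
Fixpoint li w {struct w} : nat -> barfun k :=
  fix li_w n {struct n} : barfun k := fun th =>
    (match w with
     | [::] => 0
     | false :: w' => bar_cons (om g12) (li w' n) th
     | true :: w' => bar_cons (om g23) (li w' n) th
                     + bar_cons (om g12 - om g23) (li_xy (block n ++ w')) th
     end)
    + (if n is n'.+1 then bar_cons (om g45) (li_w n') th
       else bar_cons (om g34) (li_xy w) th).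

Arguments li : simpl never.

Lemma liE w n th : li w n th =
    (match w with
     | [::] => 0
     | false :: w' => bar_cons (om g12) (li w' n) th
     | true :: w' => bar_cons (om g23) (li w' n) th
                     + bar_cons (om g12 - om g23) (li_xy (block n ++ w')) th
     end)
    + (if n is n'.+1 then bar_cons (om g45) (li w n') th
       else bar_cons (om g34) (li_xy w) th).
Proof. by case: w n => [|[] w] []. Qed.

Lemma li_xy_linear w : linear_fun (li_xy w).
Proof. exact: bar_word_linear. Qed.

Lemma li_linear w n : linear_fun (li w n).
Proof.
have xy := li_xy_linear.
elim: w n => [|c w IHw] n; elim: n => [|n IHn] a f g; rewrite !liE ?mulr0 ?add0r.
- by rewrite bar_cons_linear.
- by rewrite bar_cons_linear.
- by case: c; rewrite !bar_cons_linear //; ring.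
- by case: c IHn => IHn; rewrite !bar_cons_linear //; ring.
Qed.

Lemma li_homogeneous w n : homogeneous (size w + n).+1 (li w n).
Proof.
have xy := bar_word_homogeneous; have cons := bar_cons_homogeneous.
have xyh v : homogeneous (size v) (li_xy v).
  by have := xy [seq if c then om g24 else om g12 + om g45 | c <- v]; rewrite size_map.
elim: w n => [|c w IHw] n; elim: n => [|n IHn] f; rewrite !liE.
- by congr (_ + _); apply: cons; exact: xyh.
- by congr (_ + _); apply: cons; exact: IHn.
- congr (_ + _); last by rewrite addn0; apply: cons; exact: xyh.
  case: c; last by apply: cons; exact: IHw.
  congr (_ + _); apply: cons; first exact: IHw.
  by have := xyh (block 0 ++ w); rewrite /= addn0.
- congr (_ + _); last by rewrite addnS; apply: cons; exact: IHn.
  case: c {IHn}; last by apply: cons; exact: IHw.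
  congr (_ + _); apply: cons; first exact: IHw.
  by have := xyh (block n.+1 ++ w); rewrite size_cat size_rcons size_nseq addnC addnS.
Qed.

Lemma li_mul w n p h : linear_form p ->
  li w n (p * h) =
    (match w with
     | [::] => 0
     | false :: w' => pairing (om g12) p * li w' n h
     | true :: w' => pairing (om g23) p * li w' n h
          + (pairing (om g12) p - pairing (om g23) p) * li_xy (block n ++ w') h
     end)
    + (if n is n'.+1 then pairing (om g45) p * li w n' h
       else pairing (om g34) p * li_xy w h).
Proof.
move=> lp; have xy := li_xy_linear; have ll := li_linear; rewrite liE -pairingB.
by case: w n => [|[] w] [|n]; rewrite !bar_cons_mul //.
Qed.

Lemma li_xy_mul w p h : linear_form p ->
  li_xy w (p * h) =
    match w with
    | [::] => 0
    | false :: w' => (pairing (om g12) p + pairing (om g45) p) * li_xy w' h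
    | true :: w' => pairing (om g24) p * li_xy w' h
    end.
Proof.
move=> lp; have xy := li_xy_linear; rewrite -pairingD.
case: w => [|[] w]; last 2 first.
- exact: (bar_cons_mul _ _ (xy w) lp).
- exact: (bar_cons_mul _ _ (xy w) lp).
by rewrite /li_xy /= /bar_nil /coef smul_nilE lp // mul0r.
Qed.

(** The bivector of p and q is orthogonal to the four relations between the
    products of the forms; for the dual basis this means that the commutator of
    p and q is a combination of the quadratic relations of p5. *)
Definition flat p q : Prop :=
  let wedge e e' := pairing (om e) p * pairing (om e') q
                    - pairing (om e') p * pairing (om e) q in
  [/\ wedge g45 g34 = 0, wedge g12 g23 = 0, wedge g24 g12 + wedge g24 g45 = 0 &
      wedge g34 g24 + wedge g24 g23 + wedge g12 g24 = wedge g34 g23].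

(** The equations solved for one monomial each, to rewrite with them. *)
Lemma flatP p q : flat p q ->
  let P e := pairing (om e) p in let Q e := pairing (om e) q in
  [/\ P g45 * Q g34 = P g34 * Q g45, P g12 * Q g23 = P g23 * Q g12,
      P g24 * Q g12 = P g12 * Q g24 - P g24 * Q g45 + P g45 * Q g24 &
      P g34 * Q g24 = P g24 * Q g34 - P g24 * Q g23 + P g23 * Q g24
        - P g12 * Q g24 + P g24 * Q g12 + P g34 * Q g23 - P g23 * Q g34].
Proof.
case=> e1 e2 e3 e4; split.
- by apply/eqP; rewrite -subr_eq0 e1.
- by apply/eqP; rewrite -subr_eq0 e2.
- by apply/eqP; rewrite -subr_eq0 -e3; apply/eqP; ring.
- by apply/eqP; rewrite -subr_eq0 -(subrr (pairing (om g34) p * pairing (om g23) q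
   - pairing (om g23) p * pairing (om g34) q)) -{1}e4; apply/eqP; ring.
Qed.

Lemma li_xy_flat w p q h : linear_form p -> linear_form q -> flat p q ->
  li_xy w (p * (q * h)) = li_xy w (q * (p * h)).
Proof.
move=> lp lq /flatP[_ _ e3 _]; rewrite !li_xy_mul //.
by case: w => [|[] [|[] w]] //; rewrite !li_xy_mul // ?mulr0 //; ring: e3.
Qed.

(** Both sides unfold to two steps of the recursion; in each case the
    difference is a combination of the four equations, with coefficients
    functionals of the same family. *)
Lemma li_flat w n p q h : linear_form p -> linear_form q -> flat p q ->
  li w n (p * (q * h)) = li w n (q * (p * h)).
Proof.
move=> lp lq /flatP[e1 e2 e3 e4]; rewrite !li_mul //.
case: w => [|c w].
  by case: n => [|[|n]]; rewrite !(li_mul, li_xy_mul) //; ring: e1.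
case: n => [|[|n]]; case: c; rewrite !(li_mul, li_xy_mul) //;
case: w => [|[] w]; rewrite /=; first [ring: e1 e2 e3 | ring: e2 e4].
Qed.

End Polylogarithms.
End BarFunctionals.
Arguments li : simpl never.

(** * Integrability *)

Section Annihilation.
Variable k : comNzRingType.
Local Notation B := (series k gen5).
Implicit Types (f g h p q r u : B) (l : barfun k).

Definition annihilates r l := forall u h, l (u * (r * h)) = 0.

(** Vanishing on the two-sided ideal of r is proved by peeling off the first
    letter of the left factor. *)
Lemma annihilates_rec r l : linear_fun l -> (forall h, l (r * h) = 0) ->
  (forall e u h, l (letter e * (u * (r * h))) = 0) -> annihilates r l.
Proof.
move=> ll l0 lS u h; rewrite -(subst_id u) subst_rec // mulrDl mulr_suml.
rewrite -scalerAl mul1r ll l0 mulr0 add0r linear_fun_sum //.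
by rewrite big1 // => e _; rewrite -mulrA.
Qed.

Variables (om : gen5 -> Defs.form k) (p q : B).
Hypotheses (lp : linear_form p) (lq : linear_form q) (pq : flat om p q).

Lemma li_xy_annihilates w : annihilates (bracket p q) (li_xy om w).
Proof.
have ll := li_xy_linear om; elim: w => [|c w IH]; apply: annihilates_rec => //.
- by move=> h; rewrite mulrBl linear_funB // -!mulrA (li_xy_flat _ _ lp lq pq) subrr.
- by move=> e u h; rewrite li_xy_mul //; exact: linear_form_letter.
- by move=> h; rewrite mulrBl linear_funB // -!mulrA (li_xy_flat _ _ lp lq pq) subrr.
- move=> e u h; rewrite li_xy_mul //; last exact: linear_form_letter.
  by case: c; rewrite IH mulr0.
Qed.

Lemma li_annihilates w n : annihilates (bracket p q) (li om w n).
Proof.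
have ll := li_linear om; have xy := li_xy_annihilates.
have base v m h : li om v m (bracket p q * h) = 0.
  by rewrite mulrBl linear_funB // -!mulrA (li_flat _ _ _ lp lq pq) subrr.
elim: w n => [|c w IHw] n; elim: n => [|n IHn]; apply: annihilates_rec => // e u h;
  rewrite li_mul ?xy ?IHn ?mulr0 ?add0r //; try exact: linear_form_letter.
- by case: c; rewrite IHw ?xy !mulr0 ?addr0.
- by case: c {IHn}; rewrite IHw ?xy !mulr0 ?addr0.
Qed.

End Annihilation.

(** * A retraction of p5 onto five generators *)

Section Retraction.
Variable k : comNzRingType.
Local Notation B := (series k gen5).
Local Notation G := (series k p5_gens).

(** Coordinates of x_ij on x45, x34, x24, x12, x23, with the label 5 read as 0.
    The six remaining generators come from the row relations: for instance
    x15 = x23 + x24 + x34 and x13 = x45 - x12 - x23. *)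
Definition x_coord (i j : nat) : seq int :=
  match minn i j, maxn i j with
  | 0%N, 1%N => [:: 0; 1; 1; 0; 1]    | 0%N, 2%N => [:: 0; 0; -1; -1; -1]
  | 0%N, 3%N => [:: -1; -1; 0; 1; 0]  | 0%N, 4%N => [:: 1; 0; 0; 0; 0]
  | 1%N, 2%N => [:: 0; 0; 0; 1; 0]    | 1%N, 3%N => [:: 1; 0; 0; -1; -1]
  | 1%N, 4%N => [:: -1; -1; -1; 0; 0] | 2%N, 3%N => [:: 0; 0; 0; 0; 1]
  | 2%N, 4%N => [:: 0; 0; 1; 0; 0]    | 3%N, 4%N => [:: 0; 1; 0; 0; 0]
  | _, _ => [:: 0; 0; 0; 0; 0]
  end.

Definition gen5_index (e : gen5) : nat :=
  match e with g45 => 0 | g34 => 1 | g24 => 2 | g12 => 3 | g23 => 4 end.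

Definition coord (i j : nat) (e : gen5) : int := (x_coord i j)`_(gen5_index e).

Definition retr (x : p5_gens) : B := \sum_e (coord x.1 x.2 e)%:~R *: letter e.

Lemma retr_linear x : linear_form (retr x).
Proof.
move=> w w1; rewrite /retr ssumE big1 // => e _.
by rewrite sscaleE linear_form_letter ?mulr0.
Qed.

Lemma retrE x e : retr x [:: e] = (coord x.1 x.2 e)%:~R.
Proof.
rewrite /retr ssumE (bigD1 e) //= sscaleE /letter eqxx mulr1 big1 ?addr0 // => e' e'e.
by rewrite sscaleE eqseq_cons andbT eq_sym (negPf e'e) mulr0.
Qed.

Lemma linear_form_eq (u v : B) : linear_form u -> linear_form v ->
  (forall e, u [:: e] = v [:: e]) -> u = v.
Proof.
move=> lu lv uv; apply: funext => w; case: (boolP (size w == 1%N)) => w1.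
  by case: w w1 => [|e []] //.
by rewrite lu // lv.
Qed.

Lemma retrK e : retr (gen5_p5 e) = letter e.
Proof.
apply: linear_form_eq => [||e']; [exact: retr_linear|exact: linear_form_letter|].
by rewrite retrE /letter eqseq_cons andbT; case: e; case: e'.
Qed.

Lemma retr_sym i j : retr (i, j) = retr (j, i).
Proof. by rewrite /retr /coord /x_coord /= minnC maxnC. Qed.

Lemma retr_diag i : retr (i, i) = 0.
Proof.
apply: linear_form_eq => // [|e]; first exact: retr_linear.
rewrite retrE /coord /x_coord /= minnn maxnn szeroE.
by case: i => -[|[|[|[|[|]]]]] //= _; case: e.
Qed.

Lemma retr_sum i : \sum_j retr (i, j) = 0.
Proof.
apply: linear_form_eq => // [w w1|e].
  by rewrite ssumE big1 // => j _; rewrite retr_linear.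
rewrite ssumE szeroE; under eq_bigr do rewrite retrE.
rewrite -rmorph_sum !big_ord_recl big_ord0.
by case: i => -[|[|[|[|[|]]]]] //= ?; case: e.
Qed.

(** Integral version of [flat] for two generators, decided by computation. *)
Definition flat_coord (s : gen5 -> gen5) (i j l m : nat) : bool :=
  let w e e' := coord i j (s e) * coord l m (s e') - coord i j (s e') * coord l m (s e) in
  [&& w g45 g34 == 0, w g12 g23 == 0, w g24 g12 + w g24 g45 == 0 &
      w g34 g24 + w g24 g23 + w g12 g24 == w g34 g23].

Lemma flat_coord_disjoint (i j l m : 'I_5) :
  i \notin [:: l; m] -> j \notin [:: l; m] ->
  flat_coord id i j l m /\ flat_coord gen5_swap i j l m.
Proof.
have H : all (fun i => all (fun j => all (fun l => all (fun m =>
    (i \in [:: l; m]) || (j \in [:: l; m]) ||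
    (flat_coord id i j l m && flat_coord gen5_swap i j l m))
    (iota 0 5)) (iota 0 5)) (iota 0 5)) (iota 0 5).
  by vm_compute.
have mem (a : 'I_5) : (a : nat) \in iota 0 5 by rewrite mem_iota /= ltn_ord.
move/allP/(_ _ (mem i))/allP/(_ _ (mem j))/allP/(_ _ (mem l))/allP/(_ _ (mem m)) : H.
rewrite !in_cons !in_nil !orbF -!val_eqE /=.
by move=> /orP[/orP[->|->]|/andP[]].
Qed.

Lemma pairing_omega e (p : B) : pairing (omega k e) p = p [:: e].
Proof.
rewrite /pairing (bigD1 e) //= ffunE eqxx mul1r big1 ?addr0 // => e' e'e.
by rewrite ffunE (negPf e'e) mul0r.
Qed.

Lemma flat_retr (s : gen5 -> gen5) (i j l m : 'I_5) : flat_coord s i j l m ->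
  flat (omega k \o s) (retr (i, j)) (retr (l, m)).
Proof.
case/and4P => /eqP e1 /eqP e2 /eqP e3 /eqP e4.
by split; rewrite /= !pairing_omega !retrE -!intrM -!intrB -?intrD ?e1 ?e2 ?e3 ?e4.
Qed.

(** Only commutators of generators with disjoint labels have to be
    annihilated: the linear relations already hold after [retr]. *)
Definition flat_om (om : gen5 -> Defs.form k) : Prop :=
  forall i j l m, i \notin [:: l; m] -> j \notin [:: l; m] ->
    flat om (retr (i, j)) (retr (l, m)).

Lemma flat_omega : flat_om (omega k).
Proof. by move=> i j l m h1 h2; apply: (@flat_retr id); case: (flat_coord_disjoint h1 h2). Qed.

Lemma flat_omega_swap : flat_om (omega k \o gen5_swap).
Proof. by move=> i j l m h1 h2; apply: flat_retr; case: (flat_coord_disjoint h1 h2). Qed.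

Lemma hcomp_subst (X : finType) (Y : choiceType) (s : X -> series k Y) N f :
  (forall x, linear_form (s x)) -> hcomp N (subst s f) = subst s (hcomp N f).
Proof.
move=> ls; apply: funext => w; elim: w N f => [|c w IH] N f.
  by rewrite {1}/hcomp !subst_nil.
rewrite -[RHS]/(dR c _ w) dR_subst // /hcomp /=; case: N => [|N].
  rewrite big1 ?subst0 // => x _.
  by rewrite (_ : dR x _ = 0) ?scaler0 //; apply: funext.
rewrite eqSS -[LHS]/(hcomp N (dR c (subst s f)) w) dR_subst // IH.
rewrite hcomp_sum; congr (subst _ _ w); apply: eq_bigr => x _.
by rewrite hcompZ.
Qed.

(** The factors u and h make the induction on the ideal go through
    multiplication on both sides. *)
Lemma li_env_ideal om w n (f : G) : flat_om om -> env_ideal (@p5_rel k) f ->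
  forall u h, li om w n (u * (subst retr f * h)) = 0.
Proof.
move=> hom; have r0 x : retr x [::] = 0 by exact: retr_linear.
have ll := li_linear om w n.
elim=> [r hr||f1 g _ IHf _ IHg|f1 g _ IH|f1 g _ IH] u h.
- case: hr => [i j|i|i|i j l m h1 h2].
  + by rewrite substB !subst_letter // retr_sym subrr mul0r mulr0 linear_fun0.
  + by rewrite subst_letter // retr_diag mul0r mulr0 linear_fun0.
  + rewrite subst_sum; under eq_bigr do rewrite subst_letter //.
    by rewrite retr_sum mul0r mulr0 linear_fun0.
  + rewrite /bracket substB !substM // !subst_letter //.
    by apply: li_annihilates; [exact: retr_linear|exact: retr_linear|exact: hom].
- by rewrite subst0 mul0r mulr0 linear_fun0.
- by rewrite substD mulrDl mulrDr linear_funD // IHf IHg addr0.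
- by rewrite substM // -mulrA mulrA IH.
- by rewrite substM // -mulrA IH.
Qed.

(** The retraction [retr] sends the relations of p5 into the ideal annihilated
    by [li]; homogeneity reduces the closed ideal to a single degree. *)
Lemma li_integrable om w n : flat_om om -> integrable (li om w n).
Proof.
move=> hom th th' /pi_env_eq/asboolP/(_ (size w + n).+1) hN.
have ll := li_linear om w n.
have r0 x : retr x [::] = 0 by exact: retr_linear.
have lin e : linear_form (letter (gen5_p5 e) : G) by exact: linear_form_letter.
rewrite -substB hcomp_subst // in hN.
apply/eqP; rewrite -subr_eq0 -linear_funB // li_homogeneous.
have := li_env_ideal w n hom hN 1 1; rewrite mul1r mulr1 subst_comp //.
under [X in subst X]funext => e do rewrite subst_letter // retrK.
by rewrite subst_id => ->.
Qed.

End Retraction.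

(** * The pentagon defect in five generators *)

Section Congruence.
Variables (k : comNzRingType) (X : finType) (Y : choiceType).
Variable rel : series k Y -> Prop.
Implicit Types (s : X -> series k Y).

Lemma hcomp_linear_mul N (u g : series k Y) : linear_form u ->
  hcomp N.+1 (u * g) = u * hcomp N g.
Proof.
move=> lu; apply: funext => -[|c w]; first by rewrite /hcomp /= smul_nilE lu ?mul0r.
rewrite -[RHS]/(dR c _ w) dR_linear_mul // /hcomp /= eqSS.
by rewrite -[(u * g) _]/(dR c _ w) dR_linear_mul // !sscaleE /=; case: ifP; rewrite ?mulr0.
Qed.

(** Substituting congruent linear forms gives congruent series: replace the
    first letter, then recurse in lower degree. *)
Lemma subst_congr s s' f :
  (forall x, linear_form (s x)) -> (forall x, linear_form (s' x)) ->
  (forall x, env_ideal rel (s x - s' x)) ->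
  subst s f - subst s' f \in env_cideal rel.
Proof.
move=> ls ls' ss'; apply/asboolP => N; elim: N f => [|N IH] f.
  suff -> : hcomp 0 (subst s f - subst s' f) = 0 by exact: env_ideal0.
  apply: funext => -[|c w]; rewrite /hcomp //= saddE soppE !subst_nil //.
  by rewrite subrr.
rewrite (subst_rec _ f) ?(@subst_rec _ _ _ s') => [|x|x]; [|exact: ls'|exact: ls].
rewrite opprD addrACA subrr add0r -sumrB hcomp_sum.
apply: (big_ind (env_ideal rel)) => [||x _]; [exact: env_ideal0|exact: env_idealD|].
have -> : s x * subst s (dR x f) - s' x * subst s' (dR x f) =
    (s x - s' x) * subst s (dR x f) + s' x * (subst s (dR x f) - subst s' (dR x f)).
  by rewrite mulrBl mulrBr addrA subrK.
rewrite hcompD !hcomp_linear_mul //; last by apply/linear_formD/linear_formN.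
by apply: env_idealD; [apply: env_idealMr|apply: env_idealMl].
Qed.

End Congruence.

Section Defect.
Variable k : fieldType.
Hypothesis two_neq0 : 2%:R != 0 :> k.
Local Notation B := (series k gen5).
Local Notation G := (series k p5_gens).
Local Notation x i j := (letter (p5_label i, p5_label j) : G).
Local Notation ideal := (env_ideal (@p5_rel k)).
Local Notation e45 := (letter g45 : B).
Local Notation e34 := (letter g34 : B).
Local Notation e24 := (letter g24 : B).
Local Notation e12 := (letter g12 : B).
Local Notation e23 := (letter g23 : B).

Lemma env_idealN (f : G) : ideal f -> ideal (- f).
Proof. by move=> hf; rewrite -scaleN1r; apply: env_idealZ. Qed.

Lemma x_sym i j : ideal (x i j - x j i).
Proof. by apply: env_ideal_rel; apply: p5_sym. Qed.

(** Adding the relations of the rows 1 and 5 and subtracting those of the rows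
    2, 3, 4 cancels the generators that join the two groups of labels and
    leaves twice the difference. *)
Lemma x15_basis : ideal (x 5 1 - (x 2 3 + x 2 4 + x 3 4)).
Proof.
pose row i : G := x i 1 + x i 2 + x i 3 + x i 4 + x i 5.
have row_ideal i : ideal (row i).
  apply: env_ideal_rel; suff -> : row i = \sum_(j < 5) letter (p5_label i, j) by exact: p5_sum.
  rewrite !big_ord_recl big_ord0 /row addr0 addrC !addrA.
  do !congr (_ + _); congr (letter (_, _)); exact: val_inj.
have diag i : ideal (x i i) by apply: env_ideal_rel; exact: p5_diag.
have E (y : nat -> nat -> G) : let r i := y i 1 + y i 2 + y i 3 + y i 4 + y i 5 in
  2%:R *: (y 5 1 - (y 2 3 + y 2 4 + y 3 4)) =
  r 1 + r 5 + - r 2 + - r 3 + - r 4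
  + (- y 1 1 + - y 5 5 + y 2 2 + y 3 3 + y 4 4)
  + ((y 2 1 - y 1 2) + (y 3 1 - y 1 3) + (y 4 1 - y 1 4)
     + (y 2 5 - y 5 2) + (y 3 5 - y 5 3) + (y 4 5 - y 5 4))
  + ((y 5 1 - y 1 5) + (y 3 2 - y 2 3) + (y 4 2 - y 2 4) + (y 4 3 - y 3 4)).
  by apply: funext => w; rewrite /= !(saddE, soppE, sscaleE); ring.
rewrite -[X in ideal X]scale1r -(mulVf two_neq0) -scalerA (E (fun i j => x i j)).
apply: env_idealZ.
apply: env_idealD.
  apply: env_idealD; last by do 5![apply: env_idealD; last exact: x_sym]; exact: x_sym.
  apply: env_idealD.
    do 3![apply: env_idealD; last by apply: env_idealN; exact: row_ideal].
    by apply: env_idealD; exact: row_ideal.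
  do 3![apply: env_idealD; last exact: diag].
  by apply: env_idealD; apply: env_idealN; exact: diag.
by do 3![apply: env_idealD; last exact: x_sym]; exact: x_sym.
Qed.

Definition alpha_series (f : series k bool) : B :=
  subst2 e45 (e23 + e24 + e34) f + subst2 e12 e23 f - subst2 e34 e23 f
  - subst2 e12 (e23 + e24 + e34) f - subst2 e45 e34 f.

Lemma pi_lieD (Z : choiceType) (rel : series k Z -> Prop) f g :
  pi_lie rel (f + g) = pi_lie rel f + pi_lie rel g.
Proof. by rewrite /pi_lie raddfD. Qed.

Lemma pi_lieN (Z : choiceType) (rel : series k Z -> Prop) f :
  pi_lie rel (- f) = - pi_lie rel f.
Proof. by rewrite /pi_lie raddfN. Qed.

(** The representative of alpha(psi) in five generators is obtained by writing
    x51 and x15 in the basis and reordering labels in the other generators. *)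
Lemma to_env_alpha (psi : fr k bool) :
  to_env (alpha psi) = gen5_series (alpha_series psi).
Proof.
pose a i j l : fr k p5_gens :=
  fr_subst (fun b : bool => if b then xf k j l else xf k i j) psi.
have -> : alpha psi = pi_lie (@p5_rel k) (a 4 5 1 + a 1 2 3 - a 4 3 2 - a 2 1 5 - a 5 4 3).
  by rewrite !(pi_lieD, pi_lieN).
rewrite to_envE; apply/pi_env_eq.
have -> : fr_val (a 4 5 1 + a 1 2 3 - a 4 3 2 - a 2 1 5 - a 5 4 3) =
  fr_val (a 4 5 1) + fr_val (a 1 2 3) - fr_val (a 4 3 2) - fr_val (a 2 1 5) - fr_val (a 5 4 3).
  by [].
pose sG f := subst (fun e => letter (gen5_p5 e)) f : G.
have sGE u v : linear_form u -> linear_form v ->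
    sG (subst2 u v psi) = subst2 (sG u) (sG v) psi.
  by move=> lu lv; rewrite /sG subst2_comp.
have lin (z : p5_gens) : linear_form (letter z : G) by exact: linear_form_letter.
have lin5 (z : gen5) : linear_form (letter z : B) by exact: linear_form_letter.
have sGl e : sG (letter e) = letter (gen5_p5 e) by rewrite /sG subst_letter.
have sGD u v : sG (u + v) = sG u + sG v by exact: substD.
have sGB u v : sG (u - v) = sG u - sG v by exact: substB.
rewrite -/(sG _) /alpha_series !(sGB, sGD) !sGE; auto.
rewrite !sGD !sGl /=.
have congr i j l (u v : G) : linear_form u -> linear_form v ->
    ideal (x i j - u) -> ideal (x j l - v) ->
    fr_val (a i j l) - subst2 u v psi \in env_cideal (@p5_rel k).
  move=> lu lv hu hv; apply: (@subst_congr _ _ _ _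
    (fun b : bool => fr_val (if b then xf k j l else xf k i j))) => -[] //; exact: lin.
have E (a1 a2 a3 a4 a5 b1 b2 b3 b4 b5 : G) :
  a1 + a2 - a3 - a4 - a5 - (b1 + b2 - b3 - b4 - b5)
  = (a1 - b1) + (a2 - b2) - (a3 - b3) - (a4 - b4) - (a5 - b5).
  by apply: funext => w; rewrite !(saddE, soppE); ring.
have triv (u : G) : ideal (u - u) by rewrite subrr; exact: env_ideal0.
have x15' : ideal (x 1 5 - (x 2 3 + x 2 4 + x 3 4)).
  rewrite -(subrK (x 5 1) (x 1 5)) -addrA; apply: env_idealD; [exact: x_sym|exact: x15_basis].
have linV : linear_form (x 2 3 + x 2 4 + x 3 4) by auto.
rewrite E; apply: rpredB; [apply: rpredB; [apply: rpredB; [apply: rpredD|]|]|];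
  apply: congr => //; do ?[exact: x_sym|exact: x15_basis].
Qed.

End Defect.

(** * Indices as words *)

Section IndexWords.
Variable k : comNzRingType.
Implicit Types (a : seq nat) (w : seq bool) (l : barfun k).

Definition index_word a : seq bool := flatten [seq block ai.-1 | ai <- rev a].

Lemma index_word_rcons a p : index_word (rcons a p) = block p.-1 ++ index_word a.
Proof. by rewrite /index_word rev_rcons. Qed.

Lemma index_word_true a : is_index a -> exists w, index_word a = rcons w true.
Proof.
case: a => // a1 a _; rewrite /index_word rev_cons map_rcons flatten_rcons.
by eexists; rewrite /block -rcons_cat.
Qed.

(** The word of an index has one block x0^(a_i - 1) x1 per entry, in reverse
    order, so that every word ending in x1 is obtained. *)
Lemma index_word_onto w : exists2 a, is_index a & index_word a = rcons w true.
Proof.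
elim: w => [|[] w [a ia aw]]; first by exists [:: 1%N].
  exists (rcons a 1%N); last by rewrite index_word_rcons aw.
  by move: ia; rewrite /is_index all_rcons => /andP[_ ->]; case: (a).
case/lastP: a ia aw => [|a [|p]] //; first by rewrite /is_index all_rcons andbF.
rewrite /is_index all_rcons => /andP[_ ia] aw.
exists (rcons a p.+2); first by rewrite all_rcons; case: (a) ia.
by rewrite index_word_rcons -[rcons (_ :: _) _]/(false :: rcons w true) -aw index_word_rcons.
Qed.

Variable om : gen5 -> Defs.form k.

Lemma bar_cons_scale al l l' (b : k) th :
  (forall th', l th' = b * l' th') -> bar_cons al l th = b * bar_cons al l' th.
Proof.
by move=> ll'; rewrite /bar_cons mulr_sumr; apply: eq_bigr => e _; rewrite ll' mulrCA.
Qed.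

Lemma l_xy_li a th : l_xy om a th = (-1) ^+ size a * li_xy om (index_word a) th.
Proof.
congr (_ * bar_word _ _); rewrite /polylog_word /index_word map_flatten -map_comp.
by congr flatten; apply: eq_map => i /=; rewrite /block map_rcons map_nseq.
Qed.

Lemma l_y_li n th : l_y om [:: n.+1] th = - li om [::] n th.
Proof.
rewrite /l_y /= expr1 mulN1r /polylog_word /= cats0; congr (- _).
elim: n th => [|n IH] th; first by rewrite liE add0r.
by rewrite liE add0r; apply: eq_bigr => e _; rewrite -IH.
Qed.

Lemma l_gen_li a n th : all (leq 1) a ->
  l_gen om a [:: n.+1] th = (-1) ^+ (size a).+1 * li om (index_word a) n th.
Proof.
(* The recursion lowers the weight, but need not shorten a or b. *)
have [m] := ubnP (sumn a + n); elim: m a n th => // m IH a n th.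
case/lastP: a => [|a [|p]]; first by rewrite l_gen_nill l_y_li expr1 mulN1r.
  by rewrite all_rcons.
rewrite sumn_rcons all_rcons ltnS => am /= ia.
rewrite (@l_genE _ om a p [::] n) // size_rcons [in RHS]liE mulrDr.
congr (_ + _); last first.
  case: n am => [|n] am /=.
    rewrite l_gen_nilr; last by case: (a).
    rewrite (bar_cons_scale _ _ (l_xy_li _)) size_rcons [in RHS]exprS mulN1r mulNr.
    by [].
  rewrite [in LHS](bar_cons_scale _ _ (fun th' => IH (rcons a p.+1) n th' _ _)).
  - by rewrite size_rcons.
  - by rewrite sumn_rcons; move: am; rewrite addnS.
  - by rewrite all_rcons.
rewrite index_word_rcons; case: p am => [|p] am /=.
  rewrite [X in - X](bar_cons_scale _ _ (fun th' => IH a n th' _ _)) //; last first.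
    by move: am; rewrite addn1 addSn.
  rewrite l_gen_nilr; last by case: (a).
  rewrite [X in _ - X](bar_cons_scale _ _ (l_xy_li _)) size_rcons index_word_rcons /=.
  by rewrite !exprS; ring.
rewrite [in LHS](bar_cons_scale _ _ (fun th' => IH (rcons a p.+1) n th' _ _)).
- by rewrite size_rcons index_word_rcons.
- by rewrite sumn_rcons; move: am; rewrite !addnS addSn.
- by rewrite all_rcons.
Qed.

End IndexWords.

(** * Values on the five terms of the defect *)

Section Evaluation.
Variables (k : comNzRingType) (om : gen5 -> Defs.form k) (u v : series k gen5).
Hypotheses (lu : linear_form u) (lv : linear_form v).
Implicit Types (w : seq bool) (n : nat) (f : series k bool).
Local Notation P e := (pairing (om e) u).
Local Notation Q e := (pairing (om e) v).

Lemma li_xy_subst2 w f : li_xy om w (subst2 u v f) =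
  match w with
  | [::] => f [::]
  | false :: w' => (P g12 + P g45) * li_xy om w' (subst2 u v (dR false f))
                   + (Q g12 + Q g45) * li_xy om w' (subst2 u v (dR true f))
  | true :: w' => P g24 * li_xy om w' (subst2 u v (dR false f))
                  + Q g24 * li_xy om w' (subst2 u v (dR true f))
  end.
Proof.
have xy := li_xy_linear om; rewrite -!pairingD.
case: w => [|[] w]; first by rewrite /li_xy /= /bar_nil /coef subst2_nil.
- exact: (bar_cons_subst2 _ _ (xy w)).
- exact: (bar_cons_subst2 _ _ (xy w)).
Qed.

Lemma li_subst2 w n f : li om w n (subst2 u v f) =
  (match w with
   | [::] => 0
   | false :: w' => P g12 * li om w' n (subst2 u v (dR false f))
                    + Q g12 * li om w' n (subst2 u v (dR true f))
   | true :: w' => P g23 * li om w' n (subst2 u v (dR false f))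
       + Q g23 * li om w' n (subst2 u v (dR true f))
       + ((P g12 - P g23) * li_xy om (block n ++ w') (subst2 u v (dR false f))
          + (Q g12 - Q g23) * li_xy om (block n ++ w') (subst2 u v (dR true f)))
   end)
  + (if n is n'.+1 then P g45 * li om w n' (subst2 u v (dR false f))
                        + Q g45 * li om w n' (subst2 u v (dR true f))
     else P g34 * li_xy om w (subst2 u v (dR false f))
          + Q g34 * li_xy om w (subst2 u v (dR true f))).
Proof.
have xy := li_xy_linear om; have ll := li_linear om; rewrite liE -!pairingB.
by case: w n => [|[] w] [|n]; rewrite !bar_cons_subst2.
Qed.

End Evaluation.

Section FiveValues.
Variable k : comNzRingType.
Local Notation B := (series k gen5).
Implicit Types (w : seq bool) (n : nat) (f : series k bool).
Local Notation om := (omega k).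
Local Notation e45 := (letter g45 : B).
Local Notation e34 := (letter g34 : B).
Local Notation e24 := (letter g24 : B).
Local Notation e12 := (letter g12 : B).
Local Notation e23 := (letter g23 : B).
Local Notation e15 := (e23 + e24 + e34).

Lemma pairing_letter e e' : pairing (om e) (letter e') = (e == e')%:R.
Proof. by rewrite pairing_omega /letter eqseq_cons andbT. Qed.

Lemma pairing_e15 e : pairing (om e) e15 = (e \in [:: g23; g24; g34])%:R.
Proof.
rewrite pairing_omega !saddE /letter !eqseq_cons !andbT.
by case: e => /=; rewrite ?addr0 ?add0r.
Qed.

Lemma linear_e e : linear_form (letter e : B). Proof. exact: linear_form_letter. Qed.
Lemma linear_e15 : linear_form e15.
Proof. by apply: linear_formD; first apply: linear_formD; exact: linear_form_letter. Qed.
Hint Resolve linear_e linear_e15 : core.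

Definition pairingE := (pairing_letter, pairing_e15,
  mul0r, mul1r, add0r, addr0, subr0, sub0r, mulN1r, oppr0).

Lemma li_xy_45_15 w f : li_xy om w (subst2 e45 e15 f) = f w.
Proof.
elim: w f => [|[] w IH] f; rewrite li_xy_subst2 ?pairingE //=;
by rewrite !pairingE IH.
Qed.

(** This is the value at x = 1: the two terms of the recursion at the letter x1
    cancel, leaving the polylogarithm of the concatenated index. *)
Lemma li_45_15 w n f : li om w n (subst2 e45 e15 f) = f (block n ++ w).
Proof.
have xy := li_xy_45_15.
elim: w n f => [|c w IHw] n; elim: n => [|n IHn] f; rewrite li_subst2 //.
- by rewrite !pairingE xy.
- by rewrite !pairingE IHn.
- by case: c; rewrite /= !pairingE /= ?xy ?IHw ?dRE /=; ring.
- by case: c IHn => IHn; rewrite /= !pairingE /= ?xy ?IHw ?IHn ?dRE /=; ring.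
Qed.

Lemma li_xy_12_15 w f : li_xy om w (subst2 e12 e15 f) = f w.
Proof.
elim: w f => [|[] w IH] f; rewrite li_xy_subst2 ?pairingE //=;
by rewrite !pairingE IH.
Qed.

(** This is the value at y = 1: each letter x1 of w contributes, with the
    opposite sign, its terms of the harmonic product; for b1 = 1 the
    regularisation adds the shuffle with x1. *)
Lemma li_12_15 w n f : li om w n (subst2 e12 e15 f) =
  (if n == 0%N then ins true f w else 0) - repl (harm_letter n) f w.
Proof.
have xy := li_xy_12_15.
elim: w n f => [|c w IHw] n f; rewrite li_subst2 //.
  by case: n => [|n]; rewrite !pairingE /= ?pairingE ?xy.
case: c n => -[|n]; rewrite /= !pairingE /= ?pairingE ?xy ?IHw /harm_letter /= ?dRE; ring.
Qed.

Lemma li_xy_34_23 w f : li_xy om w (subst2 e34 e23 f) =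
  if w is [::] then f [::] else 0.
Proof. by case: w => [|[] w]; rewrite li_xy_subst2 ?pairingE //= !pairingE. Qed.

Lemma li_34_23 w n f : li om w n (subst2 e34 e23 f) =
  if (n == 0%N) && (false \notin w) then f (rcons w false) else 0.
Proof.
have xy := li_xy_34_23.
elim: w n f => [|c w IHw] n f; rewrite li_subst2 //.
  by case: n => [|n]; rewrite !pairingE /= ?pairingE ?xy.
by case: c n => -[|n]; rewrite /= !pairingE /= ?pairingE ?xy ?IHw /= ?pairingE.
Qed.

Lemma li_xy_12_23 w f : true \in w -> li_xy om w (subst2 e12 e23 f) = 0.
Proof.
elim: w f => [|[] w IH] f // wT; rewrite li_xy_subst2 //= !pairingE /= ?pairingE //.
exact: IH.
Qed.

Lemma li_12_23 w n f : li om w n (subst2 e12 e23 f) = 0.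
Proof.
have xy m w' g : li_xy om (block m ++ w') (subst2 e12 e23 g) = 0.
  by apply: li_xy_12_23; rewrite mem_cat mem_rcons mem_head.
elim: w n f => [|c w IHw] n f; rewrite li_subst2 //.
  by case: n => [|n]; rewrite !pairingE /= ?pairingE.
by case: c; case: n => [|n]; rewrite /= !pairingE /= ?pairingE
  ?(xy 0%N) ?(xy _.+1) ?IHw ?mulr0 ?subr0 ?addr0.
Qed.

Lemma li_xy_45_34 w f : true \in w -> li_xy om w (subst2 e45 e34 f) = 0.
Proof.
elim: w f => [|[] w IH] f // wT; rewrite li_xy_subst2 //= !pairingE /= ?pairingE //.
exact: IH.
Qed.

Lemma li_45_34 w n f : true \in w -> li om w n (subst2 e45 e34 f) = 0.
Proof.
move=> wT; elim: n f => [|n IHn] f; rewrite li_subst2 //.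
  by case: w wT => [|[] w] // wT; rewrite /= !pairingE /= ?pairingE li_xy_45_34.
by case: w wT IHn => [|[] w] // wT IHn; rewrite /= !pairingE /= ?pairingE IHn.
Qed.

End FiveValues.

(** * The equivalence *)

Section DefectValues.
Variable k : fieldType.
Hypothesis char0 : [pchar k] =i pred0.
Variable psi : fr k bool.
Hypothesis psi_x0 : subst2 x0 0 psi = 0.
Hypothesis psi_skew : (psi : series k bool) = - subst2 x1 x0 psi.
Implicit Types (w : seq bool) (n : nat) (a : seq nat).

Let psi_lie : lie_series psi. Proof. exact: (asboolW (fr_valP psi)). Qed.
Let two_neq0 : 2%:R != 0 :> k. Proof. exact: (natS_neq0 char0 1). Qed.

Lemma linear_fun_alpha (l : barfun k) (f : series k bool) : linear_fun l ->
  l (alpha_series f) =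
    l (subst2 (letter g45) (letter g23 + letter g24 + letter g34) f)
    + l (subst2 (letter g12) (letter g23) f)
    - l (subst2 (letter g34) (letter g23) f)
    - l (subst2 (letter g12) (letter g23 + letter g24 + letter g34) f)
    - l (subst2 (letter g45) (letter g34) f).
Proof. by move=> ll; rewrite /alpha_series !linear_funB // linear_funD. Qed.

(** Two of the five terms vanish, and the shuffle with x1 in the value at y = 1
    vanishes on psi. *)
Lemma li_alpha w n : true \in w ->
  li (omega k) w n (alpha_series psi) = harm n psi w - harm_defect psi n w.
Proof.
move=> wT; rewrite linear_fun_alpha; last exact: li_linear.
rewrite li_45_15 li_12_23 li_34_23 li_12_15 li_45_34 //.
have -> : ins true psi w = 0 by rewrite (ins_psi psi_lie psi_x0 psi_skew).
by rewrite /harm -/(harm_defect psi n w) if_same; ring.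
Qed.

Lemma subst2_skew (u v : series k gen5) : linear_form u -> linear_form v ->
  subst2 u v psi = - subst2 v u psi.
Proof.
move=> lu lv; rewrite {1}psi_skew {1}/subst2 substN.
have lb (b : bool) : (if b then v else u) [::] = 0 by case: b; [apply: lv|apply: lu].
rewrite subst2_comp; [|exact: linear_x1|exact: linear_x0|exact: lb].
by rewrite !subst_letter.
Qed.

Lemma li_subst2_eq om om' (u v u' v' : series k gen5) w n f :
  linear_form u -> linear_form v -> linear_form u' -> linear_form v' ->
  (forall e, pairing (om e) u = pairing (om' e) u') ->
  (forall e, pairing (om e) v = pairing (om' e) v') ->
  li om w n (subst2 u v f) = li om' w n (subst2 u' v' f).
Proof.
move=> lu lv lu' lv' uu' vv'.
have xy x g : li_xy om x (subst2 u v g) = li_xy om' x (subst2 u' v' g).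
  elim: x g => [|[] x IH] g; by rewrite li_xy_subst2 // [RHS]li_xy_subst2 // ?uu' ?vv' ?IH.
elim: w n f => [|c w IHw] n; elim: n => [|n IHn] f;
  rewrite li_subst2 // [RHS]li_subst2 // !uu' !vv'.
- by rewrite !xy.
- by rewrite !IHn.
- by case: c; rewrite !xy !IHw.
- by case: c IHn => IHn; rewrite ?xy !IHw !IHn.
Qed.

(** The exchange permutes the five terms of alpha(psi): the first with the
    fourth, the second with the fifth, and the third becomes its opposite by
    skewness.  Only the pairings of forms with linear parts matter. *)
Lemma li_swap_alpha w n :
  li (omega k \o gen5_swap) w n (alpha_series psi)
  = - li (omega k) w n (alpha_series psi).
Proof.
have le e : linear_form (letter e : series k gen5) by exact: linear_form_letter.
have l15 := linear_e15 k.
rewrite !linear_fun_alpha; try exact: li_linear.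
have sw e e' : pairing ((omega k \o gen5_swap) e) (letter e') =
    pairing (omega k e) (letter (gen5_swap e')).
  by rewrite /= !pairing_letter; case: e; case: e'.
have sw15 e : pairing ((omega k \o gen5_swap) e) (letter g23 + letter g24 + letter g34) =
    pairing (omega k e) (letter g23 + letter g24 + letter g34).
  by rewrite /= !pairing_e15; case: e.
have E e v v' : linear_form v -> linear_form v' ->
    (forall e', pairing ((omega k \o gen5_swap) e') v = pairing (omega k e') v') ->
    li (omega k \o gen5_swap) w n (subst2 (letter e) v psi) =
    li (omega k) w n (subst2 (letter (gen5_swap e)) v' psi).
  by move=> lv lv' vv'; apply: li_subst2_eq.
rewrite !(E _ _ _ l15 l15 sw15) !(E _ _ _ (le _) (le _) (fun e => sw e _)) /=.
rewrite (@subst2_skew (letter g23)) // -scaleN1r.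
by rewrite (linear_funZ _ _ (li_linear _ _ _)); ring.
Qed.

Lemma bar_eval_alpha om a n : flat_om om -> is_index a ->
  bar_eval (l_gen om a [:: n.+1]) (to_env (alpha psi)) =
  (-1) ^+ (size a).+1 * li om (index_word a) n (alpha_series psi).
Proof.
move=> hom /andP[_ ia]; rewrite to_env_alpha // bar_evalE ?l_gen_li //.
move=> th th' thE; rewrite !l_gen_li //.
by rewrite (li_integrable _ _ hom thE).
Qed.

(** The scalar b is 1 for the x,y functionals and - 1 for the y,x ones. *)
Lemma index_alphaP om (b : k) : flat_om om -> b != 0 ->
  (forall w n, li om w n (alpha_series psi)
               = b * li (omega k) w n (alpha_series psi)) ->
  (forall a b1, is_index a -> (1 <= b1)%N ->
     bar_eval (l_gen om a [:: b1]) (to_env (alpha psi)) = 0)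
  <-> harm 0 psi = harm_correction psi.
Proof.
move=> hom b0 hli.
rewrite (harm_correctionP char0 (ins_psi psi_lie psi_x0 psi_skew false)).
split=> [H n w | H a [//|n] ia _].
  have [a ia aw] := index_word_onto w.
  have /eqP := H a n.+1 ia isT; rewrite bar_eval_alpha // hli aw li_alpha; last first.
    by rewrite mem_rcons mem_head.
  by rewrite mulf_eq0 signr_eq0 mulf_eq0 (negPf b0) subr_eq0 /= => /eqP.
have [w aw] := index_word_true ia.
rewrite bar_eval_alpha // hli aw li_alpha; last by rewrite mem_rcons mem_head.
by rewrite H subrr !mulr0.
Qed.

End DefectValues.

Theorem theoremB (k : fieldType) (char0 : [pchar k] =i pred0)
    (psi : fr k bool) (psi_skew : Skew psi)
    (psi_c01 : coef [:: false; true] psi = 0) :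
  [<-> rc0 psi;
       forall (a : seq nat) (b1 : nat), is_index a -> (1 <= b1)%N ->
         bar_eval (lyx a [:: b1]) (to_env (alpha psi)) = 0;
       forall (a : seq nat) (b1 : nat), is_index a -> (1 <= b1)%N ->
         bar_eval (lxy a [:: b1]) (to_env (alpha psi)) = 0;
       let eta := subst2 (- x0 - x1) x1 psi in
       mu eta = subst2 (x0 + x1) 0 (dR true eta) - dR true eta
                - subst2 x1 0 (dR true eta)].
Proof.
have [[psi_x0 _] skew] := psi_skew.
have psi_lie : lie_series psi := asboolW (fr_valP psi).
have rc0P : rc0 psi <-> harm 0 psi = harm_correction psi.
  rewrite -(reduced_coactionP psi_lie psi_x0 skew).
  by split=> [[[]]|].
have lxyP := index_alphaP char0 psi_x0 skew (@flat_omega k) (oner_neq0 k)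
  (fun w n => esym (mul1r _)).
have N1_neq0 : -1 != 0 :> k by rewrite oppr_eq0 oner_neq0.
have lyxP := index_alphaP char0 psi_x0 skew (@flat_omega_swap k) N1_neq0
  (fun w n => etrans (li_swap_alpha skew w n) (esym (mulN1r _))).
have etaP := substituted_coactionP psi_lie psi_x0 skew.
tfae.
- by move/rc0P/lyxP.
- by move/lyxP/lxyP.
- by move/lxyP/etaP.
- by move/etaP/rc0P.
Qed.
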